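(* Let $T>0$, let $g\colon\mathbb{R}\to\mathbb{R}$ and $f\colon\mathbb{R}\times\mathbb{R}\to\mathbb{R}$ be $C^2$ functions with $f$ $T$-periodic in its first variable, and let $p_0\in\mathbb{R}$ be an isolated $T$-resonant zero of $g$. Consider, for $\lambda\in[0,\infty)$, the equation $$\dot x=g(x)+\lambda f(t,x).\qquad(\ast)$$ Then: (i) Let $g''(p_0)\int_0^Tf(s,p_0)\,ds>0$. Then, given $\varepsilon>0$, there exists $\lambda_*>0$ such that equation $(\ast)$ has no $T$-periodic solutions that lie in $[p_0-\varepsilon,p_0+\varepsilon]$ for $\lambda\in[0,\lambda_*]$. (ii) Let $g''(p_0)\int_0^Tf(s,p_0)\,ds<0$. Assume that $f$ has a separated variable form, that is, there exist functions $\varphi$ and $h$ such that $f(t,x)=\varphi(t)h(x)$ for all $(t,x)\in\mathbb{R}\times\mathbb{R}$. Suppose also that $T$ is the minimal period of $\varphi$. Then, given $\varepsilon>0$, there exists $\lambda_*>0$ such that equation $(\ast)$ has at least two geometrically distinct $T$-periodic solutions that lie in $[p_0-\varepsilon,p_0+\varepsilon]$ for $\lambda\in[0,\lambda_*]$. (iii) If $g''(p_0)\int_0^Tf(s,p_0)\,ds\neq0$, then $\mathrm{i}(g,p_0)=0$.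
   Context: A zero $p_0$ of $g$ is $T$-resonant if $g$ is $C^1$ in a neighborhood of $p_0$ and the linearized problem $\dot x=g'(p_0)x$, $x(0)=x(T)$ admits nontrivial solutions. Two $T$-periodic solutions are geometrically distinct if their images do not coincide. A solution lies in an interval if its image is contained in it. For an isolated zero $p_0$ of $g$, $\mathrm{i}(g,p_0)$ denotes the index of $p_0$, i.e. the degree $\deg(g,U)$ of the vector field $g$ (for vector fields on $\mathbb{R}$, the Brouwer degree of $g$ on $U$ with respect to $0$) in an isolating open neighborhood $U$ of $p_0$.
   Formalization: In (i) and (ii) λ ranges over (0,λ_*] instead of [0,λ_*], since at λ=0 the constant p_0 is a solution and may be the only one; in (i) ε is such that p_0 is the only zero of g in [p_0−ε,p_0+ε], since other zeros may persist. *)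

(* Defs.v *)
From Stdlib Require Import Reals List.
From Coquelicot Require Import Coquelicot.
Open Scope R_scope.

(* [ex_derive_n g k] only asserts that [Derive_n g (k-1)] is differentiable, so
   every order [k <= n] has to be listed. *)
Definition C_n (n : nat) (g : R -> R) : Prop :=
  forall (k : nat) (x : R), (k <= n)%nat ->
    ex_derive_n g k x /\ continuous (Derive_n g k) x.

(* Joint regularity: [ex_diff_n f n] at every point says that all iterated
   partial derivatives of order at most [n] exist and are jointly continuous. *)
Definition C_n_2d (n : nat) (f : R -> R -> R) : Prop :=
  forall t x : R, ex_diff_n f n t x.

Definition periodic (T : R) (u : R -> R) : Prop := forall t : R, u (t + T) = u t.

Definition minimal_period (T : R) (u : R -> R) : Prop :=
  0 < T /\ periodic T u /\ forall S : R, 0 < S < T -> ~ periodic S u.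

Definition is_solution (g : R -> R) (f : R -> R -> R) (lam : R) (x : R -> R) : Prop :=
  forall t : R, is_derive x t (g (x t) + lam * f t (x t)).

Definition is_periodic_solution (T : R) (g : R -> R) (f : R -> R -> R) (lam : R)
    (x : R -> R) : Prop :=
  is_solution g f lam x /\ periodic T x.

Definition lies_in (x : R -> R) (a b : R) : Prop := forall t : R, a <= x t <= b.

Definition geometrically_distinct (x y : R -> R) : Prop :=
  ~ (forall v : R, (exists t : R, x t = v) <-> (exists t : R, y t = v)).

Definition isolated_zero (g : R -> R) (p : R) : Prop :=
  g p = 0 /\
  exists delta : R, 0 < delta /\
    forall x : R, Rabs (x - p) < delta -> g x = 0 -> x = p.

Definition resonant_zero (T : R) (g : R -> R) (p : R) : Prop :=
  g p = 0 /\
  locally p (fun x => ex_derive g x /\ continuous (Derive g) x) /\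
  exists x : R -> R,
    (forall t : R, is_derive x t (Derive g p * x t)) /\
    x 0 = x T /\
    (exists t : R, x t <> 0).

Definition frontier (U : R -> Prop) (x : R) : Prop :=
  adherence U x /\ adherence (fun y => ~ U y) x.

Definition admissible (g : R -> R) (U : R -> Prop) : Prop :=
  (forall x : R, continuous g x) /\ open_set U /\ bounded U /\
  (forall x : R, frontier U x -> g x <> 0).

(* [h] is C^1, 0 is a regular value of [h] on [U], and the uniform distance of
   [h] and [g] on the closure of [U] is less than the distance from 0 to the
   image under [g] of the frontier.  The pointwise form of the last condition is
   equivalent by compactness of the closure and of the frontier. *)
Definition regular_approximation (g : R -> R) (U : R -> Prop) (h : R -> R) : Prop :=
  C_n 1 h /\
  (forall x : R, U x -> h x = 0 -> Derive h x <> 0) /\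
  (forall x y : R, adherence U x -> frontier U y -> Rabs (h x - g x) < Rabs (g y)).

(* The finite sum of sign h'(x) over the zeros x of [h] in [U]. *)
Definition regular_degree (h : R -> R) (U : R -> Prop) (d : Z) : Prop :=
  exists l : list R,
    NoDup l /\
    (forall x : R, In x l <-> U x /\ h x = 0) /\
    IZR d = fold_right Rplus 0 (map (fun x => sign (Derive h x)) l).

(* deg(g,U) = d.  The value is required of every regular approximation, and one
   has to exist, so that at most one [d] satisfies this. *)
Definition is_brouwer_degree (g : R -> R) (U : R -> Prop) (d : Z) : Prop :=
  admissible g U /\
  (exists h : R -> R, regular_approximation g U h) /\
  (forall h : R -> R, regular_approximation g U h -> regular_degree h U d).

Definition isolating_neighborhood (g : R -> R) (p : R) (U : R -> Prop) : Prop :=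
  open_set U /\ bounded U /\ U p /\
  (forall x : R, adherence U x -> g x = 0 -> x = p).

(* i(g,p) = d.  The value is the same for all isolating neighborhoods. *)
Definition is_index (g : R -> R) (p : R) (d : Z) : Prop :=
  isolated_zero g p /\
  forall U : R -> Prop, isolating_neighborhood g p U -> is_brouwer_degree g U d.

(* Main.v *)
Require Import Defs.
From Stdlib Require Import Reals List ZArith Lra Lia Classical.
From Coquelicot Require Import Coquelicot.
Open Scope R_scope.

(** Resonance forces [g' p0 = 0] ([resonant_zero_degenerate]), so with
    [a = g'' p0 <> 0] the product [a * g] is positive on both sides of [p0]
    ([degenerate_zero_sign]).  Let [I] be the integral of [f s p0] over a period.

    If [a * I > 0] ([no_periodic_solution]): where a periodic solution is extremal
    its derivative vanishes, so [g] is of size [lam] there, and for small [lam]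
    the whole solution is close to [p0].  Then [a * g >= 0] along it, while the
    integral of [a * f t (x t)] is close to [a * I > 0]; but the integral of the
    derivative of a periodic function is [0].

    If [a * I < 0] ([two_periodic_solutions]): the constants [p0 - delta] and
    [p0 + delta] are barriers of one kind, and the periodic curve
    [beta = p0 + lam * psi], where [psi] is a primitive of [f t p0] minus its mean,
    is a strict barrier of the opposite kind, because [g] is [o(lam)] along it.
    One periodic solution lies on each side of [beta].  They come from the method
    of sub- and supersolutions ([periodic_solution_between]), with time reversed
    for one of the two since there the supersolution is the lower barrier
    ([periodic_solution_between_signed]).  Solutions ordered strictly at every
    instant have different maxima, hence different images.

    For the index ([index_zero]), let [U] isolate [p0].  The function [g + c] with
    [c] small of the sign of [a] has no zeros in [U], so it is a regular
    approximation.  Any regular approximation [h] has finitely many zeros in [U]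
    ([regular_zeros_listed]) and shares the sign of [g] on the frontier.  On a
    component [(c, d)] of [U] the signs of [h'] at the zeros add up to
    [(sign (h d) - sign (h c)) / 2] ([interval_degree]).  This is [0], as [g]
    changes sign in no component, not even in the one of [p0]. *)

(** * Continuity, mean values and monotonicity *)

Lemma continuous_eps_delta (u : R -> R) (x : R) :
  continuous u x <->
  forall eps, 0 < eps ->
    exists d, 0 < d /\ forall y, Rabs (y - x) < d -> Rabs (u y - u x) < eps.
Proof.
  split.
  - intros H eps He.
    destruct (proj1 (filterlim_locally u (u x)) H (mkposreal eps He)) as [d Hd].
    exists d; split; [apply cond_pos|]. intros y Hy. exact (Hd y Hy).
  - intros H. apply filterlim_locally. intros eps.
    destruct (H eps (cond_pos eps)) as [d [Hd HH]].
    exists (mkposreal d Hd). intros y Hy. exact (HH y Hy).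
Qed.

Lemma continuous_continuity (u : R -> R) :
  (forall x, continuous u x) -> continuity u.
Proof. intros H x. apply continuity_pt_filterlim. exact (H x). Qed.

Lemma is_derive_continuous (u : R -> R) (x l : R) :
  is_derive u x l -> continuous u x.
Proof. intros H. apply (ex_derive_continuous u). now exists l. Qed.

Lemma continuous_2d_comp (F : R -> R -> R) (u : R -> R) (t : R) :
  continuity_2d_pt F t (u t) -> continuous u t -> continuous (fun s => F s (u s)) t.
Proof.
  intros HF Hu. apply continuous_eps_delta. intros eps He.
  destruct (HF (mkposreal eps He)) as [d Hd]. simpl in Hd.
  destruct (proj1 (continuous_eps_delta u t) Hu d (cond_pos d)) as [d' [Hd' H']].
  exists (Rmin d d'). split; [apply Rmin_pos; [apply cond_pos|assumption]|].
  intros y Hy. pose proof (Rmin_l d d'). pose proof (Rmin_r d d').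
  apply Hd; [lra|]. apply H'. lra.
Qed.

(** The intermediate point is kept strictly on the same side of [p] as [x]: this
    is what lets signs be read off when the mean value theorem is iterated. *)
Lemma mean_value (u u' : R -> R) (p x : R) :
  (forall y, is_derive u y (u' y)) -> x <> p ->
  exists c, Rabs (c - p) < Rabs (x - p) /\ 0 < (c - p) * (x - p) /\
    u x - u p = u' c * (x - p).
Proof.
  intros Hu Hx.
  assert (Hd : forall y, derivable_pt_lim u y (u' y))
    by (intros y; apply is_derive_Reals, Hu).
  destruct (Rtotal_order x p) as [Hl|[He|Hl]]; [|contradiction|].
  - destruct (MVT_cor2 u u' x p Hl (fun c _ => Hd c)) as [c [Hc Hc']].
    exists c. rewrite !Rabs_left by lra. repeat split; [lra|nra|lra].
  - destruct (MVT_cor2 u u' p x Hl (fun c _ => Hd c)) as [c [Hc Hc']].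
    exists c. rewrite !Rabs_right by lra. repeat split; [lra|nra|lra].
Qed.

Lemma derive_pos_increasing (u u' : R -> R) (s t : R) :
  (forall y, is_derive u y (u' y)) -> (forall y, 0 < u' y) -> s < t -> u s < u t.
Proof.
  intros Hu Hp Hst.
  destruct (mean_value u u' s t Hu) as [c [_ [_ Hc]]]; [lra|].
  specialize (Hp c). nra.
Qed.

Lemma derive_nonneg_nondecreasing (u u' : R -> R) (s t : R) :
  (forall y, is_derive u y (u' y)) -> (forall y, 0 <= u' y) -> s <= t -> u s <= u t.
Proof.
  intros Hu Hp Hst. destruct (Req_dec t s) as [->|Hn]; [lra|].
  destruct (mean_value u u' s t Hu Hn) as [c [_ [_ Hc]]].
  specialize (Hp c). nra.
Qed.

Lemma derive_zero_constant (u : R -> R) (s t : R) :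
  (forall y, is_derive u y 0) -> u t = u s.
Proof.
  intros Hu. destruct (Req_dec t s) as [->|Hn]; [reflexivity|].
  destruct (mean_value u (fun _ => 0) s t Hu Hn) as [c [_ [_ Hc]]]. lra.
Qed.

Lemma derive_at_extremum (s : R) (u : R -> R) (t l : R) :
  s <> 0 -> is_derive u t l -> (forall y, s * u y <= s * u t) -> l = 0.
Proof.
  intros Hs Hu Hmax.
  assert (Hd : derivable_pt_lim (fun y => s * u y) t (s * l))
    by (apply is_derive_Reals, (is_derive_scal u t s l Hu)).
  pose (pr := exist _ (s * l) Hd : derivable_pt (fun y => s * u y) t).
  assert (H : s * l = 0).
  { change (derive_pt (fun y => s * u y) t pr = 0).
    apply deriv_maximum with (t - 1) (t + 1); [lra|lra|]. intros; apply Hmax. }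
  destruct (Rmult_integral _ _ H); [contradiction|assumption].
Qed.

(** * Gluing on a compact interval *)

(** The supremum of the [c] with [Q a c] can be passed by the local hypothesis
    there, so it is [b].  Compactness of a segment is used in this form
    throughout: for upper bounds, for positive lower bounds and for finiteness. *)
Lemma interval_gluing (Q : R -> R -> Prop) (a b : R) :
  a <= b ->
  (forall u v w, Q u v -> Q v w -> Q u w) ->
  (forall x, a <= x <= b ->
     exists d, 0 < d /\ forall u v, x - d < u <= x -> x <= v < x + d -> Q u v) ->
  Q a b.
Proof.
  intros Hab Htr Hloc.
  set (E := fun c => a <= c <= b /\ Q a c).
  assert (Ea : E a).
  { split; [lra|]. destruct (Hloc a) as [d [Hd H]]; [lra|]. apply H; lra. }
  destruct (completeness E) as [c [Hub Hlub]].
  { exists b. intros x [Hx _]. lra. }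
  { now exists a. }
  assert (Hac : a <= c) by (apply Hub, Ea).
  assert (Hcb : c <= b) by (apply Hlub; intros x [Hx _]; lra).
  destruct (Hloc c) as [d [Hd H]]; [lra|].
  assert (exists c', E c' /\ c - d < c') as [c' [[Hc' HQ] Hcd]].
  { apply NNPP. intros Hn. assert (c <= c - d); [|lra]. apply Hlub.
    intros x Hx. apply Rnot_lt_le. intros Hlt. apply Hn. exists x. split; [exact Hx|lra]. }
  assert (Hc'c : c' <= c) by (apply Hub; split; assumption).
  assert (Hext : forall v, c <= v < c + d -> Q a v).
  { intros v Hv. apply Htr with c'; [exact HQ|]. apply H; lra. }
  destruct (Rle_lt_dec b c) as [Hle|Hlt].
  - replace b with c by lra. apply Hext; lra.
  - pose (v := Rmin b (c + d / 2)).
    assert (Hv : c < v /\ v <= b /\ v < c + d).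
    { unfold v. pose proof (Rmin_l b (c + d/2)). pose proof (Rmin_r b (c + d/2)).
      repeat split; [apply Rmin_glb_lt; lra|lra|lra]. }
    assert (v <= c); [|lra]. apply Hub. split; [lra|]. apply Hext; lra.
Qed.

Lemma bounded_on_rectangle (F : R -> R -> R) (a b A B : R) :
  a <= b -> A <= B ->
  (forall t x, continuity_2d_pt F t x) ->
  exists M, forall t x, a <= t <= b -> A <= x <= B -> Rabs (F t x) <= M.
Proof.
  intros Hab HAB HF.
  apply (interval_gluing (fun u v => exists M, forall t x,
           u <= t <= v -> A <= x <= B -> Rabs (F t x) <= M) a b Hab).
  { intros u v w [M HM] [N HN]. exists (Rmax M N). intros t x Ht Hx.
    pose proof (Rmax_l M N). pose proof (Rmax_r M N).
    destruct (Rle_dec t v); [specialize (HM t x)|specialize (HN t x)]; lra. }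
  intros t Ht.
  assert (exists d M, 0 < d /\ forall s x, Rabs (s - t) < d -> A <= x <= B ->
            Rabs (F s x) <= M) as [d [M [Hd HM]]].
  { apply (interval_gluing (fun u v => exists d M, 0 < d /\ forall s x,
             Rabs (s - t) < d -> u <= x <= v -> Rabs (F s x) <= M) A B HAB).
    { intros u v w [d [M [Hd HM]]] [e [N [He HN]]].
      exists (Rmin d e), (Rmax M N). split; [now apply Rmin_pos|]. intros s x Hs Hx.
      pose proof (Rmax_l M N). pose proof (Rmax_r M N).
      pose proof (Rmin_l d e). pose proof (Rmin_r d e).
      destruct (Rle_dec x v); [specialize (HM s x)|specialize (HN s x)]; lra. }
    intros x Hx. destruct (HF t x (mkposreal 1 Rlt_0_1)) as [d Hd]. simpl in Hd.
    exists d. split; [apply cond_pos|]. intros u v Hu Hv.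
    exists d, (Rabs (F t x) + 1). split; [apply cond_pos|]. intros s y Hs Hy.
    assert (Hyx : Rabs (y - x) < d) by (apply Rabs_def1; lra).
    specialize (Hd s y Hs Hyx).
    pose proof (Rabs_triang (F s y - F t x) (F t x)) as Htri.
    replace (F s y - F t x + F t x) with (F s y) in Htri by ring. lra. }
  exists d. split; [exact Hd|]. intros u v Hu Hv. exists M. intros s x Hs Hx.
  apply HM; [|exact Hx]. apply Rabs_def1; lra.
Qed.

(** * Periodic functions *)

Lemma period_shift (T t : R) :
  0 < T ->
  exists n, 0 <= t - IZR n * T <= T /\
    forall u : R -> R, periodic T u -> u (t - IZR n * T) = u t.
Proof.
  intros HT.
  assert (Hnat : forall (u : R -> R), periodic T u -> forall n t, u (t + INR n * T) = u t).
  { intros u Hu n. induction n as [|n IH]; intros s.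
    - simpl. f_equal. ring.
    - rewrite S_INR. replace (s + (INR n + 1) * T) with (s + INR n * T + T) by ring.
      rewrite Hu. apply IH. }
  exists (Int_part (t / T)). split.
  - destruct (base_Int_part (t / T)) as [H1 H2].
    set (n := IZR (Int_part (t / T))) in *.
    assert (Ht : t = t / T * T) by (field; lra). nra.
  - intros u Hu. set (n := Int_part (t / T)).
    destruct (Z_le_dec 0 n) as [Hn|Hn].
    + rewrite <- (Z2Nat.id n Hn), <- INR_IZR_INZ.
      rewrite <- (Hnat u Hu (Z.to_nat n)). f_equal. ring.
    + replace (t - IZR n * T) with (t + INR (Z.to_nat (- n)) * T); [apply Hnat, Hu|].
      rewrite INR_IZR_INZ, Z2Nat.id by lia. rewrite opp_IZR. ring.
Qed.

Lemma periodic_max (T : R) (u : R -> R) :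
  0 < T -> periodic T u -> (forall t, continuous u t) ->
  exists t, forall s, u s <= u t.
Proof.
  intros HT Hper Hc.
  destruct (continuity_ab_maj u 0 T) as [t [Ht _]]; [lra| |].
  { intros c _. apply continuous_continuity, Hc. }
  exists t. intros s. destruct (period_shift T s HT) as [n [Hn Hs]].
  rewrite <- (Hs u Hper). now apply Ht.
Qed.

Lemma continuous_opp_fun (u : R -> R) t : continuous u t -> continuous (fun s => - u s) t.
Proof. intros H. apply (continuous_opp u t H). Qed.

Lemma periodic_bounded (T : R) (u : R -> R) :
  0 < T -> periodic T u -> (forall t, continuous u t) ->
  exists B, 0 < B /\ forall t, Rabs (u t) <= B.
Proof.
  intros HT Hper Hc.
  destruct (periodic_max T u HT Hper Hc) as [t Ht].
  destruct (periodic_max T (fun s => - u s) HT) as [t' Ht'].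
  { intros s. now rewrite Hper. }
  { intros s. now apply continuous_opp_fun. }
  exists (Rabs (u t) + Rabs (u t') + 1).
  pose proof (Rabs_pos (u t)). pose proof (Rabs_pos (u t')).
  split; [lra|]. intros s. specialize (Ht s). specialize (Ht' s). simpl in Ht'.
  pose proof (Rle_abs (u t)). pose proof (Rle_abs (- u t')). rewrite Rabs_Ropp in *.
  apply Rabs_le. lra.
Qed.

Lemma periodic_from_derivative (T : R) (u u' : R -> R) :
  (forall t, is_derive u t (u' t)) -> periodic T u' -> u T = u 0 -> periodic T u.
Proof.
  intros Hu Hper HT t.
  assert (H : u (t + T) - u t = u (0 + T) - u 0).
  { apply (derive_zero_constant (fun s => u (s + T) - u s)). intros s.
    replace 0 with (1 * u' (s + T) - u' s) by (rewrite Hper; ring).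
    apply (is_derive_minus (fun s => u (s + T)) u); [|apply Hu].
    apply (is_derive_comp u (fun s => s + T)); [apply Hu|]. auto_derive; [trivial|ring]. }
  rewrite Rplus_0_l in H. lra.
Qed.

Lemma is_derive_primitive (q : R -> R) (t : R) :
  (forall s, continuous q s) -> is_derive (fun t => RInt q 0 t) t (q t).
Proof.
  intros Hq. apply (is_derive_RInt q (fun t => RInt q 0 t) 0 t); [|apply Hq].
  apply filter_forall. intros s. apply (RInt_correct q). apply (ex_RInt_continuous q).
  intros; apply Hq.
Qed.

(** * Periodic solutions of scalar equations *)

Lemma is_derive_exp_mult (K : R) (w : R -> R) (t w' : R) :
  is_derive w t w' ->
  is_derive (fun s => exp (K * s) * w s) t (exp (K * t) * (w' + K * w t)).
Proof.
  intros Hw. auto_derive; [now exists w'|].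
  rewrite (is_derive_unique (fun x : R => w x) t w' Hw). ring.
Qed.

Lemma exp_period_growth (K T t : R) :
  0 < K -> 0 < T -> exp (K * t) < exp (K * (t + T)).
Proof. intros. apply exp_increasing. nra. Qed.

(** [exp (K t) w t] increases, so over one period the factor [exp (K T) - 1 > 0]
    transfers the sign of [w' + K w] to [w]. *)
Lemma periodic_comparison (T K : R) (w w' : R -> R) :
  0 < T -> 0 < K -> periodic T w ->
  (forall t, is_derive w t (w' t)) -> (forall t, 0 <= w' t + K * w t) ->
  forall t, 0 <= w t.
Proof.
  intros HT HK Hper Hw Hp t.
  assert (H : exp (K * t) * w t <= exp (K * (t + T)) * w (t + T)).
  { apply (derive_nonneg_nondecreasing (fun s => exp (K * s) * w s)
             (fun s => exp (K * s) * (w' s + K * w s))); [| |lra].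
    - intros s. now apply is_derive_exp_mult.
    - intros s. apply Rmult_le_pos; [left; apply exp_pos|apply Hp]. }
  rewrite Hper in H. pose proof (exp_period_growth K T t HK HT). nra.
Qed.

(** The periodic solution of [x' + K x = q], by variation of constants; the
    constant is the one that makes the values at [0] and [T] agree. *)
Definition periodic_linear (T K : R) (q : R -> R) (t : R) : R :=
  let Q := RInt (fun s => exp (K * s) * q s) 0 in
  exp (- K * t) * (Q T / (exp (K * T) - 1) + Q t).

Lemma is_derive_periodic_linear (T K : R) (q : R -> R) (t : R) :
  (forall s, continuous q s) ->
  is_derive (periodic_linear T K q) t (q t - K * periodic_linear T K q t).
Proof.
  intros Hq. unfold periodic_linear. set (Q := RInt (fun s => exp (K * s) * q s) 0).
  set (C := Q T / _).
  assert (HQ : is_derive Q t (exp (K * t) * q t)).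
  { apply (is_derive_primitive (fun s => exp (K * s) * q s)). intros s.
    apply (continuous_mult (fun s => exp (K * s)) q); [|apply Hq].
    apply (is_derive_continuous _ s (K * exp (K * s))). auto_derive; [trivial|ring]. }
  evar_last.
  { apply (is_derive_mult (fun s => exp (- K * s)) (fun s => C + Q s)).
    - instantiate (1 := - K * exp (- K * t)). auto_derive; [trivial|ring].
    - instantiate (1 := exp (K * t) * q t). auto_derive; [now exists (exp (K * t) * q t)|].
      rewrite (is_derive_unique (fun x : R => Q x) t _ HQ). ring.
    - intros; apply Rmult_comm. }
  unfold plus, mult; simpl.
  assert (He : exp (- K * t) * exp (K * t) = 1).
  { rewrite <- exp_plus. replace (- K * t + K * t) with 0 by ring. apply exp_0. }
  replace (exp (- K * t) * (exp (K * t) * q t)) with (q t * (exp (- K * t) * exp (K * t))) by ring.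
  rewrite He. ring.
Qed.

Lemma periodic_linear_periodic (T K : R) (q : R -> R) :
  0 < T -> 0 < K -> periodic T q -> (forall s, continuous q s) ->
  periodic T (periodic_linear T K q).
Proof.
  intros HT HK Hper Hq. set (x := periodic_linear T K q).
  assert (Hx : forall t, is_derive x t (q t - K * x t))
    by (intros; now apply is_derive_periodic_linear).
  assert (HT0 : x T = x 0).
  { unfold x, periodic_linear. set (Q := RInt (fun s => exp (K * s) * q s) 0).
    assert (HQ0 : Q 0 = 0) by (apply (RInt_point 0 (fun s => exp (K * s) * q s))).
    rewrite HQ0, !Rmult_0_r, exp_0.
    pose proof (exp_period_growth K T 0 HK HT) as Hg.
    rewrite Rmult_0_r, exp_0, Rplus_0_l in Hg.
    replace (- K * T) with (- (K * T)) by ring. rewrite exp_Ropp. field.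
    split; [lra|]. pose proof (exp_pos (K * T)). lra. }
  (* Both [x] and its translate solve the same equation. *)
  intros t. set (z := fun s => exp (K * s) * (x (s + T) - x s)).
  assert (Hz : z t = z 0).
  { apply derive_zero_constant. intros s. unfold z.
    replace 0 with (exp (K * s) * (((q (s + T) - K * x (s + T)) - (q s - K * x s))
                      + K * (x (s + T) - x s))) by (rewrite Hper; ring).
    apply (is_derive_exp_mult K (fun s => x (s + T) - x s)).
    apply (is_derive_minus (fun s => x (s + T)) x); [|apply Hx].
    replace (q (s + T) - K * x (s + T)) with (1 * (q (s + T) - K * x (s + T))) by ring.
    apply (is_derive_comp x (fun s => s + T)); [apply Hx|]. auto_derive; [trivial|ring]. }
  unfold z in Hz. rewrite Rplus_0_l, HT0 in Hz.
  pose proof (exp_pos (K * t)). nra.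
Qed.

(** A pointwise limit may be differentiated as soon as the difference quotients
    at the point are controlled uniformly in the index, for then the bound
    passes to the limit. *)
Lemma is_derive_pointwise_limit (u : nat -> R -> R) (y : R -> R) (t l : R) :
  (forall s, is_lim_seq (fun n => u n s) (y s)) ->
  (forall eps, 0 < eps -> exists d N, 0 < d /\
     forall n s, (N <= n)%nat -> Rabs (s - t) < d ->
       Rabs (u n s - u n t - l * (s - t)) <= eps * Rabs (s - t)) ->
  is_derive y t l.
Proof.
  intros Hlim Hunif. apply is_derive_Reals. intros eps Heps.
  destruct (Hunif (eps / 2)) as [d [N [Hd HN]]]; [lra|].
  exists (mkposreal d Hd). simpl. intros h Hh Hhd.
  assert (Hy : Rabs (y (t + h) - y t - l * h) <= eps / 2 * Rabs h).
  { apply (is_lim_seq_le (fun n => Rabs (u (n + N)%nat (t + h) - u (n + N)%nat t - l * h))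
             (fun _ => eps / 2 * Rabs h)
             (Rabs (y (t + h) - y t - l * h)) (eps / 2 * Rabs h)).
    - intros n. specialize (HN (n + N)%nat (t + h)).
      replace (t + h - t) with h in HN by ring. apply HN; [lia|exact Hhd].
    - apply (is_lim_seq_incr_n (fun n => Rabs (u n (t + h) - u n t - l * h)) N).
      apply (is_lim_seq_abs _ (Finite (y (t + h) - y t - l * h))).
      apply (is_lim_seq_minus' (fun n => u n (t + h) - u n t) (fun _ => l * h));
        [|apply is_lim_seq_const].
      apply is_lim_seq_minus'; apply Hlim.
    - apply is_lim_seq_const. }
  replace ((y (t + h) - y t) / h - l) with ((y (t + h) - y t - l * h) / h) by (field; exact Hh).
  unfold Rdiv. rewrite Rabs_mult, Rabs_inv.
  pose proof (Rabs_pos_lt h Hh) as Hp.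
  apply Rmult_lt_reg_r with (Rabs h); [exact Hp|].
  rewrite Rmult_assoc, Rinv_l by lra. nra.
Qed.

(** Monotone iteration.  With [F t x + K x] nondecreasing in [x], solving
    [x' + K x = F t u + K u] for a periodic [x] is monotone in [u], so iterating
    from [alpha] gives an increasing sequence below [beta].  The iterates share
    a Lipschitz constant, which makes their pointwise limit a solution. *)
Lemma periodic_solution_between (T : R) (F : R -> R -> R) (K M A B : R)
    (alpha alpha' beta beta' : R -> R) :
  0 < T -> 0 < K ->
  (forall t x, continuity_2d_pt F t x) ->
  (forall t x, F (t + T) x = F t x) ->
  (forall t x, A <= x <= B -> Rabs (F t x) <= M) ->
  (forall t x y, A <= x -> x <= y -> y <= B -> F t x + K * x <= F t y + K * y) ->
  (forall t, is_derive alpha t (alpha' t)) -> periodic T alpha ->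
  (forall t, is_derive beta t (beta' t)) -> periodic T beta ->
  (forall t, A <= alpha t) -> (forall t, alpha t <= beta t) -> (forall t, beta t <= B) ->
  (forall t, alpha' t <= F t (alpha t)) ->
  (forall t, F t (beta t) <= beta' t) ->
  exists x : R -> R,
    (forall t, is_derive x t (F t (x t))) /\ periodic T x /\
    (forall t, alpha t <= x t <= beta t).
Proof.
  intros HT HK Hcont HperF HM Hmono Ha HaT Hb HbT HA Hab HB Hsub Hsup.
  set (step := fun u : R -> R => periodic_linear T K (fun t => F t (u t) + K * u t)).
  set (good := fun u : R -> R => (forall t, continuous u t) /\ periodic T u /\
                                 (forall t, alpha t <= u t <= beta t)).
  assert (Hq : forall u, good u ->
            forall t, continuous (fun t => F t (u t) + K * u t) t).
  { intros u [Hu _] t. apply (continuous_plus (fun t => F t (u t)) (fun t => K * u t)).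
    - apply continuous_2d_comp; [apply Hcont|apply Hu].
    - apply (continuous_scal_r K u). apply Hu. }
  assert (HSd : forall u, good u ->
            forall t, is_derive (step u) t (F t (u t) + K * u t - K * step u t)).
  { intros u Hu t.
    exact (is_derive_periodic_linear T K (fun t => F t (u t) + K * u t) t (Hq u Hu)). }
  assert (HSp : forall u, good u -> periodic T (step u)).
  { intros u Hu. apply periodic_linear_periodic; [exact HT|exact HK| |now apply Hq].
    intros t. destruct Hu as [_ [Hu _]]. now rewrite Hu, HperF. }
  assert (Hcmp : forall v v' w w' : R -> R, periodic T v -> periodic T w ->
            (forall t, is_derive v t (v' t)) -> (forall t, is_derive w t (w' t)) ->
            (forall t, v' t + K * v t <= w' t + K * w t) -> forall t, v t <= w t).
  { intros v v' w w' Hv Hw Hdv Hdw Hle t.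
    assert (0 <= w t - v t); [|lra].
    apply (periodic_comparison T K (fun t => w t - v t) (fun t => w' t - v' t) HT HK).
    - intros s. now rewrite Hv, Hw.
    - intros s. apply (is_derive_minus w v); [apply Hdw|apply Hdv].
    - intros s. specialize (Hle s). lra. }
  assert (HSgood : forall u, good u -> good (step u)).
  { intros u Hu. pose proof Hu as [_ [_ Hub]]. split; [|split; [now apply HSp|]].
    - intros t. eapply is_derive_continuous. now apply HSd.
    - intros t. split.
      + apply (Hcmp alpha alpha' (step u) (fun t => F t (u t) + K * u t - K * step u t));
          auto. intros s. specialize (Hsub s). specialize (Hub s).
        specialize (HA s). specialize (HB s). specialize (Hmono s (alpha s) (u s)).
        assert (u s <= B) by lra. lra.
      + apply (Hcmp (step u) (fun t => F t (u t) + K * u t - K * step u t) beta beta');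
          auto. intros s. specialize (Hsup s). specialize (Hub s).
        specialize (HA s). specialize (HB s). specialize (Hmono s (u s) (beta s)).
        assert (A <= u s) by lra. lra. }
  assert (HSmono : forall u v, good u -> good v -> (forall t, u t <= v t) ->
            forall t, step u t <= step v t).
  { intros u v Hu Hv Huv.
    apply (Hcmp (step u) (fun t => F t (u t) + K * u t - K * step u t)
                (step v) (fun t => F t (v t) + K * v t - K * step v t)); auto.
    intros s. pose proof Hu as [_ [_ Hub]]. pose proof Hv as [_ [_ Hvb]].
    specialize (Hub s). specialize (Hvb s). specialize (Huv s).
    specialize (HA s). specialize (HB s). specialize (Hmono s (u s) (v s)).
    assert (A <= u s) by lra. assert (v s <= B) by lra. lra. }
  set (xs := fun n => Nat.iter n step alpha).
  assert (Hxg : forall n, good (xs n)).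
  { induction n as [|n IH]; [|exact (HSgood _ IH)]. split; [|split; [exact HaT|]].
    - intros t. eapply is_derive_continuous. apply Ha.
    - intros t. specialize (Hab t). simpl. lra. }
  assert (Hxi : forall n t, xs n t <= xs (S n) t).
  { induction n as [|n IH]; [|exact (HSmono _ _ (Hxg _) (Hxg _) IH)].
    intros t. apply (HSgood _ (Hxg 0%nat)). }
  set (y := fun t => real (Lim_seq (fun n => xs n t))).
  assert (Hy : forall t, is_lim_seq (fun n => xs n t) (y t)).
  { intros t. apply Lim_seq_correct', (ex_finite_lim_seq_incr _ (beta t)).
    - intros n. apply Hxi.
    - intros n. apply (Hxg n). }
  assert (Hyb : forall t, alpha t <= y t <= beta t).
  { intros t. split.
    - apply (is_lim_seq_incr_compare _ _ (Hy t) (fun n => Hxi n t) 0%nat).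
    - apply (is_lim_seq_le (fun n => xs n t) (fun _ => beta t) (y t) (beta t));
        [intros n; apply (Hxg n)|apply Hy|apply is_lim_seq_const]. }
  exists y. split; [|split; [|exact Hyb]].
  2: { intros t. unfold y. f_equal. apply Lim_seq_ext. intros n. apply (Hxg n). }
  set (slope n t := F t (xs n t) + K * (xs n t - xs (S n) t)).
  assert (Hxd : forall n t, is_derive (xs (S n)) t (slope n t)).
  { intros n t. replace (slope n t) with (F t (xs n t) + K * xs n t - K * step (xs n) t)
      by (unfold slope, xs; simpl; ring). exact (HSd _ (Hxg n) t). }
  set (L := M + K * (B - A) + 1).
  assert (HAB : A <= B) by (specialize (HA 0); specialize (Hab 0); specialize (HB 0); lra).
  assert (HL : 1 <= L).
  { unfold L. pose proof (HM 0 A) as H. pose proof (Rabs_pos (F 0 A)).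
    assert (0 <= K * (B - A)) by nra. lra. }
  assert (HR : forall n t, Rabs (slope n t) <= L).
  { intros n t. destruct (Hxg n) as [_ [_ H1]]. specialize (H1 t).
    destruct (Hxg (S n)) as [_ [_ H2]]. specialize (H2 t).
    specialize (HA t). specialize (HB t). specialize (HM t (xs n t)).
    assert (Hz : - M <= F t (xs n t) <= M) by (apply Rabs_le_between; lra).
    unfold slope, L. set (p := xs n t) in *. set (q := xs (S n) t) in *.
    assert (- (B - A) <= p - q <= B - A) by lra.
    apply Rabs_le. split; nra. }
  assert (Hlip : forall n s t, Rabs (xs (S n) s - xs (S n) t)
                                 <= L * Rabs (s - t)).
  { intros n s t. destruct (Req_dec s t) as [->|Hn].
    - rewrite !Rminus_diag, Rabs_R0. lra.
    - destruct (mean_value _ _ t s (Hxd n) Hn) as [c [_ [_ Hc]]].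
      rewrite Hc, Rabs_mult. apply Rmult_le_compat_r; [apply Rabs_pos|apply HR]. }
  intros t.
  apply (is_derive_pointwise_limit (fun n => xs (S n)) y).
  { intros s. apply (is_lim_seq_incr_1 (fun n => xs n s)), Hy. }
  intros eps Heps.
  destruct (Hcont t (y t) (mkposreal (eps / 2) ltac:(lra))) as [d Hd]. simpl in Hd.
  pose proof (cond_pos d) as Hdp.
  (* [e] keeps the argument of [F] within [d], and [K] times the gap between
     consecutive iterates below [eps / 2]. *)
  set (e := Rmin (d / 2) (eps / (8 * K))).
  assert (He : 0 < e).
  { apply Rmin_pos; [lra|]. apply Rdiv_lt_0_compat; lra. }
  assert (He1 : e <= d / 2) by apply Rmin_l.
  assert (He2 : K * e <= eps / 8).
  { apply Rle_trans with (K * (eps / (8 * K))).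
    - apply Rmult_le_compat_l; [lra|apply Rmin_r].
    - right. field. lra. }
  destruct (proj2 (is_lim_seq_spec _ _) (Hy t) (mkposreal e He)) as [N HN]. simpl in HN.
  assert (Hnear : forall n s, (S N <= n)%nat -> Rabs (s - t) < e / L ->
             Rabs (xs n s - y t) < 2 * e).
  { intros n s Hn Hs. destruct n as [|n]; [lia|].
    specialize (HN (S n) ltac:(lia)). specialize (Hlip n s t).
    assert (L * Rabs (s - t) < e).
    { apply Rmult_lt_compat_l with (r := L) in Hs; [|lra].
      replace (L * (e / L)) with e in Hs by (field; lra). exact Hs. }
    replace (xs (S n) s - y t) with
      ((xs (S n) s - xs (S n) t) + (xs (S n) t - y t)) by ring.
    eapply Rle_lt_trans; [apply Rabs_triang|]. lra. }
  exists (Rmin (d / 2) (e / L)), (S N). split.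
  { apply Rmin_pos; [lra|]. apply Rdiv_lt_0_compat; lra. }
  intros n s Hn Hs.
  destruct (Req_dec s t) as [->|Hst].
  { rewrite !Rminus_diag, Rabs_R0, Rmult_0_r, Rminus_diag, Rabs_R0. lra. }
  destruct (mean_value _ _ t s (Hxd n) Hst) as [c [Hc [_ Hcv]]].
  rewrite Hcv. replace (slope n c * (s - t) - F t (y t) * (s - t))
    with ((slope n c - F t (y t)) * (s - t)) by ring.
  rewrite Rabs_mult. apply Rmult_le_compat_r; [apply Rabs_pos|].
  pose proof (Rmin_l (d / 2) (e / L)). pose proof (Rmin_r (d / 2) (e / L)).
  assert (Hc1 : Rabs (xs n c - y t) < 2 * e) by (apply Hnear; [lia|lra]).
  assert (Hc2 : Rabs (xs (S n) c - y t) < 2 * e) by (apply Hnear; [lia|lra]).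
  assert (Hc3 : Rabs (F c (xs n c) - F t (y t)) < eps / 2) by (apply Hd; lra).
  apply Rabs_def2 in Hc1, Hc2, Hc3. unfold slope. apply Rabs_le. split; nra.
Qed.

Lemma is_derive_reverse (u : R -> R) (t l : R) :
  is_derive u (- t) l -> is_derive (fun s => u (- s)) t (- l).
Proof.
  intros Hu. replace (- l) with (-1 * l) by ring.
  apply (is_derive_comp u (fun s => - s)); [exact Hu|]. auto_derive; [trivial|ring].
Qed.

(** The sign [s] allows the order of sub- and supersolution to be exchanged:
    reversing time turns one into the other.  The Lipschitz bound is therefore
    asked on both sides. *)
Lemma periodic_solution_between_signed (s T : R) (F : R -> R -> R) (K M A B : R)
    (u u' v v' : R -> R) :
  s <> 0 -> 0 < T -> 0 < K ->
  (forall t x, continuity_2d_pt F t x) ->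
  (forall t x, F (t + T) x = F t x) ->
  (forall t x, A <= x <= B -> Rabs (F t x) <= M) ->
  (forall t x y, A <= x <= B -> A <= y <= B ->
     Rabs (F t y - F t x) <= K * Rabs (y - x)) ->
  (forall t, is_derive u t (u' t)) -> periodic T u ->
  (forall t, is_derive v t (v' t)) -> periodic T v ->
  (forall t, A <= u t) -> (forall t, u t <= v t) -> (forall t, v t <= B) ->
  (forall t, s * (u' t - F t (u t)) <= 0) ->
  (forall t, 0 <= s * (v' t - F t (v t))) ->
  exists x : R -> R,
    (forall t, is_derive x t (F t (x t))) /\ periodic T x /\
    (forall t, u t <= x t <= v t).
Proof.
  intros Hs HT HK Hcont HperF HM Hlip Hu HuT Hv HvT HA Huv HB Hsub Hsup.
  assert (Hrev : forall w, periodic T w -> periodic T (fun t => w (- t))).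
  { intros w Hw t. rewrite <- (Hw (- (t + T))). f_equal. ring. }
  destruct (Rlt_le_dec 0 s) as [Hp|Hn].
  - apply (periodic_solution_between T F K M A B u u' v v'); auto.
    + intros t x y Hx Hxy Hy. specialize (Hlip t x y ltac:(lra) ltac:(lra)).
      rewrite (Rabs_right (y - x)) in Hlip by lra. apply Rabs_le_between in Hlip. lra.
    + intros t. specialize (Hsub t). nra.
    + intros t. specialize (Hsup t). nra.
  - assert (Hs' : s < 0) by lra.
    destruct (periodic_solution_between T (fun t x => - F (- t) x) K M A B
                (fun t => u (- t)) (fun t => - u' (- t))
                (fun t => v (- t)) (fun t => - v' (- t))) as [x [Hx [HxT Hxb]]]; auto.
    + intros t x eps. destruct (Hcont (- t) x eps) as [d Hd]. exists d.
      intros t' x' Ht' Hx'. specialize (Hd (- t') x').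
      replace (- t' - - t) with (- (t' - t)) in Hd by ring. rewrite Rabs_Ropp in Hd.
      replace (- F (- t') x' - - F (- t) x) with (- (F (- t') x' - F (- t) x)) by ring.
      rewrite Rabs_Ropp. now apply Hd.
    + intros t x. rewrite <- (HperF (- (t + T))). do 2 f_equal. ring.
    + intros t x Hx. rewrite Rabs_Ropp. now apply HM.
    + intros t x y Hx Hxy Hy. specialize (Hlip (- t) x y ltac:(lra) ltac:(lra)).
      rewrite (Rabs_right (y - x)) in Hlip by lra. apply Rabs_le_between in Hlip. lra.
    + intros t. now apply is_derive_reverse.
    + intros t. now apply is_derive_reverse.
    + intros t. specialize (Hsub (- t)). nra.
    + intros t. specialize (Hsup (- t)). nra.
    + exists (fun t => x (- t)). split; [|split; [now apply Hrev|]].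
      * intros t. replace (F t (x (- t))) with (- - F (- - t) (x (- t)))
          by (rewrite !Ropp_involutive; reflexivity).
        apply is_derive_reverse, Hx.
      * intros t. specialize (Hxb (- t)). now rewrite Ropp_involutive in Hxb.
Qed.

(** * The zero of [g] *)

(** A nontrivial solution [x 0 * exp (b t)] of [x' = b x] is periodic only if
    [b = 0]: in dimension one, resonance means a degenerate zero. *)
Lemma resonant_zero_degenerate (T : R) (g : R -> R) (p : R) :
  0 < T -> resonant_zero T g p -> Derive g p = 0.
Proof.
  intros HT [_ [_ [x [Hx [HxT [t0 Ht0]]]]]]. set (b := Derive g p) in *.
  assert (He : forall t, exp (- b * t) * x t = x 0).
  { intros t. replace (x 0) with (exp (- b * 0) * x 0)
      by (rewrite Rmult_0_r, exp_0; ring).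
    apply (derive_zero_constant (fun s => exp (- b * s) * x s)). intros s.
    replace 0 with (exp (- b * s) * (b * x s + - b * x s)) by ring.
    apply is_derive_exp_mult, Hx. }
  pose proof (He T) as H. rewrite <- HxT in H.
  destruct (Req_dec (x 0) 0) as [Hz|Hz].
  - exfalso. apply Ht0. pose proof (He t0) as H0. rewrite Hz in H0.
    pose proof (exp_pos (- b * t0)).
    destruct (Rmult_integral _ _ H0); [lra|assumption].
  - assert (H1 : exp (- b * T) = exp 0).
    { rewrite exp_0. apply Rmult_eq_reg_r with (x 0); [lra|exact Hz]. }
    apply exp_inv in H1. destruct (Rmult_integral _ _ H1); lra.
Qed.

(** By the mean value theorem used twice,
    [g x = g'' d * (c - p) * (x - p)] with [c] on the same side of [p] as [x]. *)
Lemma degenerate_zero_sign (g : R -> R) (p : R) :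
  C_n 2 g -> g p = 0 -> Derive g p = 0 -> Derive_n g 2 p <> 0 ->
  exists r, 0 < r /\
    forall x, x <> p -> Rabs (x - p) < r -> 0 < Derive_n g 2 p * g x.
Proof.
  intros Hg Hg0 Hg1 Ha. set (a := Derive_n g 2 p) in *.
  assert (H1 : forall y, is_derive g y (Derive g y))
    by (intros y; apply Derive_correct, (Hg 1%nat y); lia).
  assert (H2 : forall y, is_derive (Derive g) y (Derive_n g 2 y))
    by (intros y; apply Derive_correct, (Hg 2%nat y); lia).
  destruct (proj1 (continuous_eps_delta _ p) (proj2 (Hg 2%nat p ltac:(lia)))
              (Rabs a) (Rabs_pos_lt a Ha)) as [r [Hr Hcr]].
  exists r. split; [exact Hr|]. intros x Hx Hxr.
  destruct (mean_value g _ p x H1 Hx) as [c [Hc [Hcs Hcv]]].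
  assert (Hcp : c <> p) by (intros ->; lra).
  destruct (mean_value (Derive g) _ p c H2 Hcp) as [d [Hd [_ Hdv]]].
  specialize (Hcr d ltac:(lra)). fold a in Hcr.
  assert (Had : 0 < a * Derive_n g 2 d).
  { apply Rabs_def2 in Hcr. destruct (Rle_lt_dec a 0).
    - rewrite Rabs_left in Hcr by lra. nra.
    - rewrite Rabs_right in Hcr by lra. nra. }
  replace (a * g x) with ((a * Derive_n g 2 d) * ((c - p) * (x - p))); [nra|].
  rewrite Hg0 in Hcv. rewrite Hg1 in Hdv.
  replace (g x) with (Derive g c * (x - p)) by lra.
  replace (Derive g c) with (Derive_n g 2 d * (c - p)) by lra. ring.
Qed.

Lemma derivative_zero_small (g : R -> R) (p eta : R) :
  is_derive g p 0 -> g p = 0 -> 0 < eta ->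
  exists r, 0 < r /\ forall x, Rabs (x - p) < r -> Rabs (g x) <= eta * Rabs (x - p).
Proof.
  intros Hg Hg0 He. apply is_derive_Reals in Hg.
  destruct (Hg eta He) as [d Hd]. exists d. split; [apply cond_pos|].
  intros x Hx. destruct (Req_dec x p) as [->|Hn].
  - rewrite Hg0, Rminus_diag, Rabs_R0. lra.
  - specialize (Hd (x - p) ltac:(lra) Hx).
    replace (p + (x - p)) with x in Hd by ring. rewrite Hg0, !Rminus_0_r in Hd.
    unfold Rdiv in Hd. rewrite Rabs_mult, Rabs_inv in Hd.
    assert (Hp : 0 < Rabs (x - p)) by (apply Rabs_pos_lt; lra).
    apply Rmult_lt_compat_r with (r := Rabs (x - p)) in Hd; [|exact Hp].
    rewrite Rmult_assoc, Rinv_l in Hd by lra. lra.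
Qed.

Lemma no_zero_same_sign (g : R -> R) (x y : R) :
  continuity g -> (forall z, Rmin x y <= z <= Rmax x y -> g z <> 0) ->
  0 < g x * g y.
Proof.
  intros Hg Hz. apply Rnot_le_lt. intros Hle.
  destruct (Rle_lt_dec x y) as [H|H].
  - destruct (IVT_cor g x y Hg H Hle) as [z [Hz1 Hz2]].
    apply (Hz z); [|exact Hz2]. now rewrite Rmin_left, Rmax_right by lra.
  - destruct (IVT_cor g y x Hg ltac:(lra) ltac:(lra)) as [z [Hz1 Hz2]].
    apply (Hz z); [|exact Hz2]. now rewrite Rmin_right, Rmax_left by lra.
Qed.

(** Some point between [p] and [x] lies within [r] of [p], and from there to [x]
    the intermediate value theorem forbids a change of sign. *)
Lemma sign_propagates (g : R -> R) (a p r x : R) :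
  continuity g -> 0 < r ->
  (forall y, y <> p -> Rabs (y - p) < r -> 0 < a * g y) ->
  x <> p ->
  (forall z, Rmin p x <= z <= Rmax p x -> g z = 0 -> z = p) ->
  0 < a * g x.
Proof.
  intros Hg Hr Hnear Hx Hz.
  destruct (Rlt_le_dec (Rabs (x - p)) r) as [Hl|Hl]; [now apply Hnear|].
  pose (k := r / (2 * Rabs (x - p))).
  assert (Hk : 0 < k <= / 2 /\ k * Rabs (x - p) = r / 2).
  { assert (0 < Rabs (x - p)) by lra. repeat split; unfold k.
    - apply Rdiv_lt_0_compat; lra.
    - apply Rmult_le_reg_r with (2 * Rabs (x - p)); [lra|].
      unfold Rdiv. rewrite Rmult_assoc, Rinv_l by lra. lra.
    - field. lra. }
  pose (y := p + k * (x - p)).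
  assert (Hy : 0 < a * g y).
  { apply Hnear; unfold y.
    - intros H. assert (k * (x - p) = 0) as H0 by lra.
      destruct (Rmult_integral _ _ H0); lra.
    - replace (p + k * (x - p) - p) with (k * (x - p)) by ring.
      rewrite Rabs_mult, (Rabs_right k) by lra. lra. }
  assert (Hs : 0 < g y * g x).
  { apply no_zero_same_sign; [exact Hg|]. intros z Hzz Hz0.
    assert (Hyz : z = p).
    { apply Hz; [|exact Hz0]. unfold y in Hzz. revert Hzz. unfold Rmin, Rmax.
      repeat destruct Rle_dec; intros; nra. }
    subst z. unfold y in Hzz. revert Hzz. unfold Rmin, Rmax.
    repeat destruct Rle_dec; intros; nra. }
  destruct (Rle_lt_dec (a * g x) 0) as [Hn|Hn]; [exfalso|exact Hn].
  assert (0 < (a * g y) * (a * g y)) by nra.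
  destruct (Rtotal_order a 0) as [|[|]]; [|subst; lra|];
    destruct (Rtotal_order (g y) 0) as [|[|]]; nra.
Qed.

(** Compactness of [C] is used through the hypothesis that its complement is
    open. *)
Lemma bounded_away_from_zero (g : R -> R) (C : R -> Prop) (p r a b : R) :
  a <= b -> 0 < r -> (forall x, continuous g x) ->
  (forall x, C x -> a <= x <= b) ->
  (forall x, ~ C x -> exists d, 0 < d /\ forall y, Rabs (y - x) < d -> ~ C y) ->
  (forall x, C x -> g x = 0 -> x = p) ->
  exists m, 0 < m /\ forall x, C x -> Rabs (g x) < m -> Rabs (x - p) < r.
Proof.
  intros Hab Hr Hg HC Hopen Hz.
  cut (exists m, 0 < m /\
         forall x, a <= x <= b -> C x -> Rabs (g x) < m -> Rabs (x - p) < r).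
  { intros [m [Hm H]]. exists m. split; [exact Hm|]. intros x Hx. apply H; auto. }
  apply (interval_gluing (fun u v => exists m, 0 < m /\
           forall x, u <= x <= v -> C x -> Rabs (g x) < m -> Rabs (x - p) < r) a b Hab).
  { intros u v w [m [Hm H]] [m' [Hm' H']]. exists (Rmin m m').
    split; [now apply Rmin_pos|]. intros x Hx HCx Hgx.
    pose proof (Rmin_l m m'). pose proof (Rmin_r m m').
    destruct (Rle_dec x v); [apply H|apply H']; auto; lra. }
  intros x Hx. destruct (classic (C x)) as [HCx|HCx].
  - destruct (Req_dec (g x) 0) as [H0|H0].
    + rewrite (Hz x HCx H0). exists r. split; [exact Hr|]. intros u v Hu Hv.
      exists 1. split; [lra|]. intros y Hy _ _. apply Rabs_def1; lra.
    + assert (Hp : 0 < Rabs (g x) / 2) by (pose proof (Rabs_pos_lt _ H0); lra).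
      destruct (proj1 (continuous_eps_delta g x) (Hg x) _ Hp) as [d [Hd Hcd]].
      exists d. split; [exact Hd|]. intros u v Hu Hv. exists (Rabs (g x) / 2).
      split; [exact Hp|]. intros y Hy _ Hgy. exfalso.
      specialize (Hcd y ltac:(apply Rabs_def1; lra)).
      pose proof (Rabs_triang_inv (g x) (g y)) as Ht. rewrite Rabs_minus_sym in Ht. lra.
  - destruct (Hopen x HCx) as [d [Hd Hnd]]. exists d. split; [exact Hd|].
    intros u v Hu Hv. exists 1. split; [lra|]. intros y Hy HCy. exfalso.
    apply (Hnd y); [apply Rabs_def1; lra|exact HCy].
Qed.

(** * The forcing term *)

Lemma forcing_continuous (f : R -> R -> R) :
  C_n_2d 2 f -> forall t x, continuity_2d_pt f t x.
Proof. intros Hf t x. apply (Hf t x). Qed.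

Lemma periodic_forcing_bounded (T : R) (f : R -> R -> R) (A B : R) :
  0 < T -> A <= B -> (forall t x, continuity_2d_pt f t x) ->
  (forall t x, f (t + T) x = f t x) ->
  exists M, 0 < M /\ forall t x, A <= x <= B -> Rabs (f t x) <= M.
Proof.
  intros HT HAB Hf Hper.
  destruct (bounded_on_rectangle f 0 T A B) as [M HM]; [lra|exact HAB|exact Hf|].
  exists (Rabs M + 1). split; [pose proof (Rabs_pos M); lra|]. intros t x Hx.
  destruct (period_shift T t HT) as [n [Hn Hs]].
  rewrite <- (Hs (fun t => f t x) (fun t => Hper t x)).
  specialize (HM _ x Hn Hx). pose proof (Rle_abs M). lra.
Qed.

Lemma lipschitz_of_derivative (u u' : R -> R) (A B L : R) :
  (forall x, is_derive u x (u' x)) -> (forall x, A <= x <= B -> Rabs (u' x) <= L) ->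
  forall x y, A <= x <= B -> A <= y <= B -> Rabs (u y - u x) <= L * Rabs (y - x).
Proof.
  intros Hu HL x y Hx Hy. destruct (Req_dec y x) as [->|Hn].
  { rewrite !Rminus_diag, Rabs_R0. lra. }
  destruct (mean_value u u' x y Hu Hn) as [c [Hc [Hs ->]]].
  rewrite Rabs_mult. apply Rmult_le_compat_r; [apply Rabs_pos|]. apply HL.
  revert Hc. unfold Rabs. repeat destruct Rcase_abs; nra.
Qed.

Lemma periodic_forcing_lipschitz (T : R) (f : R -> R -> R) (A B : R) :
  0 < T -> A <= B -> C_n_2d 2 f -> (forall t x, f (t + T) x = f t x) ->
  exists L, 0 < L /\ forall t x y, A <= x <= B -> A <= y <= B ->
    Rabs (f t y - f t x) <= L * Rabs (y - x).
Proof.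
  intros HT HAB Hf Hper.
  destruct (periodic_forcing_bounded T (fun t x => Derive (fun z => f t z) x) A B HT HAB)
    as [L [HL HLb]].
  - intros t x. destruct (Hf t x) as [_ [_ [_ [_ [H _]]]]]. exact H.
  - intros t x. apply Derive_ext. intros z. apply Hper.
  - exists L. split; [exact HL|]. intros t.
    apply (lipschitz_of_derivative (fun z => f t z) (fun x => Derive (fun z => f t z) x)).
    + intros x. apply Derive_correct. apply (Hf t x).
    + intros x. apply HLb.
Qed.

Lemma C2_lipschitz (g : R -> R) (A B : R) :
  A <= B -> C_n 2 g ->
  exists L, 0 < L /\ forall x y, A <= x <= B -> A <= y <= B ->
    Rabs (g y - g x) <= L * Rabs (y - x).
Proof.
  intros HAB Hg.
  destruct (periodic_forcing_bounded 1 (fun _ x => Derive g x) A B) as [L [HL HLb]];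
    [lra|exact HAB| |trivial|].
  - intros t x eps.
    destruct (proj1 (continuous_eps_delta _ x) (proj2 (Hg 1%nat x ltac:(lia)))
                eps (cond_pos eps)) as [d [Hd H]].
    exists (mkposreal d Hd). intros u v _ Hv. exact (H v Hv).
  - exists L. split; [exact HL|].
    apply (lipschitz_of_derivative g (Derive g)).
    + intros x. apply Derive_correct, (Hg 1%nat x). lia.
    + intros x. apply (HLb 0).
Qed.

Lemma forcing_slice_continuous (f : R -> R -> R) (p : R) :
  (forall t x, continuity_2d_pt f t x) -> forall t, continuous (fun s => f s p) t.
Proof.
  intros Hf t. apply (continuous_2d_comp f (fun _ => p)); [apply Hf|].
  apply continuous_const.
Qed.

Lemma slice_minus_const_continuous (q : R -> R) (c : R) :
  (forall s, continuous q s) -> forall s, continuous (fun s => q s - c) s.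
Proof.
  intros Hq s. apply (continuous_minus q (fun _ => c)); [apply Hq|apply continuous_const].
Qed.

Lemma RInt_minus_const (q : R -> R) (c T : R) :
  (forall s, continuous q s) ->
  RInt (fun s => q s - c) 0 T = RInt q 0 T - c * T.
Proof.
  intros Hq.
  rewrite (RInt_minus q (fun _ => c)).
  - rewrite RInt_const. unfold minus, plus, opp, scal; simpl. unfold mult; simpl. ring.
  - apply (ex_RInt_continuous q). intros; apply Hq.
  - apply ex_RInt_const.
Qed.

(** * Nonexistence of periodic solutions *)

(** At an extremum of a periodic solution [g x = - lam * f], so for small [lam]
    the solution stays where [g] is small, that is, near [p].  There
    [f t x] is close to [f t p], and [g x + lam * f t x] integrates over a
    period to something with the sign of [a], which is impossible. *)
Lemma no_periodic_solution (T : R) (g : R -> R) (f : R -> R -> R) (p a eps : R) :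
  0 < T -> 0 < eps ->
  (forall x, continuous g x) -> C_n_2d 2 f -> (forall t x, f (t + T) x = f t x) ->
  (forall x, p - eps <= x <= p + eps -> x <> p -> 0 < a * g x) ->
  g p = 0 ->
  0 < a * RInt (fun s => f s p) 0 T ->
  exists lam_star, 0 < lam_star /\
    forall lam, 0 < lam <= lam_star ->
      ~ exists x, is_periodic_solution T g f lam x /\ lies_in x (p - eps) (p + eps).
Proof.
  intros HT Heps Hg Hf Hper Hsign Hgp HI.
  assert (Hfc := forcing_continuous f Hf).
  assert (Hq := forcing_slice_continuous f p Hfc).
  set (I := RInt (fun s => f s p) 0 T) in *.
  destruct (periodic_forcing_bounded T f (p - eps) (p + eps) HT ltac:(lra) Hfc Hper)
    as [M [HM HMb]].
  destruct (periodic_forcing_lipschitz T f (p - eps) (p + eps) HT ltac:(lra) Hf Hper)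
    as [L [HL HLb]].
  set (c := I / (2 * T)).
  assert (HcT : c * T = I / 2) by (unfold c; field; lra).
  assert (Hac : 0 < a * c).
  { apply Rmult_lt_reg_r with T; [exact HT|]. rewrite Rmult_assoc, HcT. lra. }
  assert (Hc0 : 0 < Rabs c) by (apply Rabs_pos_lt; intros H; rewrite H in Hac; lra).
  set (d := Rabs c / L).
  assert (Hd : 0 < d) by (apply Rdiv_lt_0_compat; lra).
  destruct (bounded_away_from_zero g (fun x => p - eps <= x <= p + eps) p d
              (p - eps) (p + eps)) as [m [Hm Hmb]]; try assumption; try lra.
  - intros x Hx; exact Hx.
  - intros x Hx. destruct (Rlt_le_dec x (p - eps)) as [H|H].
    + exists (p - eps - x). split; [lra|]. intros y Hy. apply Rabs_def2 in Hy. lra.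
    + exists (x - (p + eps)). split; [lra|].
      intros y Hy. apply Rabs_def2 in Hy. lra.
  - intros x Hx H0. apply NNPP. intros Hn. specialize (Hsign x Hx Hn).
    rewrite H0 in Hsign. lra.
  - exists (m / (2 * M)). split; [apply Rdiv_lt_0_compat; lra|].
    intros lam Hlam [x [[Hsol HxT] Hin]].
    assert (HlamM : lam * M < m).
    { apply Rle_lt_trans with (m / (2 * M) * M); [apply Rmult_le_compat_r; lra|].
      replace (m / (2 * M) * M) with (m / 2) by (field; lra). lra. }
    assert (Hxc : forall t, continuous x t)
      by (intros t; eapply is_derive_continuous, Hsol).
    assert (Hext : forall s t, s <> 0 -> (forall y, s * x y <= s * x t) ->
              Rabs (x t - p) < d).
    { intros s t Hs Hmax. apply Hmb; [apply Hin|].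
      pose proof (derive_at_extremum s x t _ Hs (Hsol t) Hmax) as H0.
      replace (g (x t)) with (- (lam * f t (x t))) by lra.
      rewrite Rabs_Ropp, Rabs_mult, (Rabs_right lam) by lra.
      apply Rle_lt_trans with (lam * M); [|exact HlamM].
      apply Rmult_le_compat_l; [lra|]. apply HMb, Hin. }
    destruct (periodic_max T x HT HxT Hxc) as [t1 Ht1].
    destruct (periodic_max T (fun t => - x t) HT) as [t2 Ht2].
    { intros t. now rewrite HxT. }
    { intros t. now apply continuous_opp_fun. }
    simpl in Ht2.
    assert (Hx1 : Rabs (x t1 - p) < d).
    { apply (Hext 1); [lra|]. intros y. specialize (Ht1 y). lra. }
    assert (Hx2 : Rabs (x t2 - p) < d).
    { apply (Hext (-1)); [lra|]. intros y. specialize (Ht2 y). lra. }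
    set (psi := fun t => RInt (fun s => f s p - c) 0 t).
    assert (Hpsi : forall t, is_derive psi t (f t p - c)).
    { intros t. apply (is_derive_primitive (fun s => f s p - c)).
      now apply slice_minus_const_continuous. }
    assert (Hlt : a * (x 0 - lam * psi 0) < a * (x T - lam * psi T)).
    { apply (derive_pos_increasing (fun t => a * (x t - lam * psi t))
         (fun t => a * (g (x t) + lam * f t (x t) - lam * (f t p - c)))); [| |exact HT].
      - intros t. apply (is_derive_scal (fun t => x t - lam * psi t) t a).
        apply (is_derive_minus x (fun t => lam * psi t)); [apply Hsol|].
        apply (is_derive_scal psi t lam), Hpsi.
      - intros t.
        assert (Hg0 : 0 <= a * g (x t)).
        { destruct (Req_dec (x t) p) as [->|Hn]; [rewrite Hgp; lra|].
          left. apply Hsign; [apply Hin|exact Hn]. }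
        assert (Hxt : Rabs (x t - p) < d).
        { specialize (Ht1 t). specialize (Ht2 t). apply Rabs_def2 in Hx1, Hx2.
          apply Rabs_def1; lra. }
        assert (Hff : Rabs (f t (x t) - f t p) < Rabs c).
        { apply Rle_lt_trans with (L * Rabs (x t - p)).
          - apply HLb; [lra|apply Hin].
          - apply Rlt_le_trans with (L * d); [apply Rmult_lt_compat_l; lra|].
            unfold d. right. field. lra. }
        assert (0 < a * (f t (x t) - f t p + c)).
        { destruct (Rlt_le_dec 0 c) as [Hc|Hc].
          - rewrite (Rabs_right c) in Hff by lra. apply Rabs_def2 in Hff.
            assert (0 < a) by nra. nra.
          - rewrite (Rabs_left1 c) in Hff by lra. apply Rabs_def2 in Hff.
            assert (a < 0) by nra. nra. }
        nra. }
    assert (H0 : psi 0 = 0) by (apply (RInt_point 0 (fun s => f s p - c))).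
    assert (HTT : psi T = I / 2).
    { unfold psi. rewrite (RInt_minus_const (fun s => f s p) c T Hq). fold I. lra. }
    assert (Hxx : x T = x 0) by (rewrite <- (HxT 0); f_equal; ring).
    rewrite H0, HTT, Hxx in Hlt. nra.
Qed.

(** * Existence of two periodic solutions *)

(** The maximum of the lower one is not exceeded by it, while the upper one is
    larger than it at the same instant. *)
Lemma ordered_geometrically_distinct (T : R) (x y : R -> R) :
  0 < T -> periodic T x -> (forall t, continuous x t) -> (forall t, x t < y t) ->
  geometrically_distinct x y.
Proof.
  intros HT HxT Hx Hlt Himg. destruct (periodic_max T x HT HxT Hx) as [t Ht].
  destruct (proj2 (Himg (y t))) as [s Hs]; [now exists t|].
  specialize (Ht s). specialize (Hlt t). lra.
Qed.

(** With [c] the mean of [f t p], a primitive of [f t p - c] is periodic, and the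
    averaged curve [p + lam * psi] misses the equation by [- lam * c] up to
    [o(lam)], since [g] vanishes to second order.  Its defect thus has the sign
    of [a], opposite to that of the constants [p - delta] and [p + delta], so
    that a periodic solution lies on each side of it. *)
Lemma two_periodic_solutions (T : R) (g : R -> R) (f : R -> R -> R) (p a r eps : R) :
  0 < T -> 0 < eps -> 0 < r ->
  C_n 2 g -> C_n_2d 2 f -> (forall t x, f (t + T) x = f t x) ->
  g p = 0 -> Derive g p = 0 ->
  (forall x, x <> p -> Rabs (x - p) < r -> 0 < a * g x) ->
  a * RInt (fun s => f s p) 0 T < 0 ->
  exists lam_star, 0 < lam_star /\
    forall lam, 0 < lam <= lam_star ->
      exists x1 x2,
        is_periodic_solution T g f lam x1 /\ lies_in x1 (p - eps) (p + eps) /\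
        is_periodic_solution T g f lam x2 /\ lies_in x2 (p - eps) (p + eps) /\
        geometrically_distinct x1 x2.
Proof.
  intros HT Heps Hr Hg Hf Hper Hgp Hg'p Hsign HI.
  assert (Hfc := forcing_continuous f Hf).
  assert (Hq := forcing_slice_continuous f p Hfc).
  set (I := RInt (fun s => f s p) 0 T) in *.
  destruct (periodic_forcing_bounded T f (p - 1) (p + 1) HT ltac:(lra) Hfc Hper)
    as [M [HM HMb]].
  destruct (periodic_forcing_lipschitz T f (p - 1) (p + 1) HT ltac:(lra) Hf Hper)
    as [L [HL HLb]].
  destruct (C2_lipschitz g (p - 1) (p + 1) ltac:(lra) Hg) as [Lg [HLg HLgb]].
  assert (Hgd : forall y, is_derive g y (Derive g y))
    by (intros y; apply Derive_correct, (Hg 1%nat y); lia).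
  set (c := I / T).
  assert (HcT : c * T = I) by (unfold c; field; lra).
  assert (Hac : a * c < 0).
  { apply Rmult_lt_reg_r with T; [exact HT|]. rewrite Rmult_assoc, HcT. lra. }
  assert (Ha : 0 < Rabs a) by (apply Rabs_pos_lt; intros H; rewrite H in Hac; lra).
  assert (Hc0 : 0 < Rabs c) by (apply Rabs_pos_lt; intros H; rewrite H in Hac; lra).
  assert (Hacabs : a * c = - (Rabs a * Rabs c))
    by (rewrite <- Rabs_mult, Rabs_left by lra; ring).
  set (psi := fun t => RInt (fun s => f s p - c) 0 t).
  assert (Hpsi : forall t, is_derive psi t (f t p - c)).
  { intros t. apply (is_derive_primitive (fun s => f s p - c)).
    now apply slice_minus_const_continuous. }
  assert (HpsiT : periodic T psi).
  { apply (periodic_from_derivative T psi (fun t => f t p - c) Hpsi).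
    - intros t. now rewrite Hper.
    - unfold psi. rewrite (RInt_minus_const (fun s => f s p) c T Hq). fold I.
      rewrite (RInt_point 0 (fun s => f s p - c)). unfold zero; simpl. lra. }
  destruct (periodic_bounded T psi HT HpsiT) as [B [HB HBb]].
  { intros t. eapply is_derive_continuous, Hpsi. }
  destruct (derivative_zero_small g p (Rabs c / (4 * B))) as [r1 [Hr1 Hsmall]].
  { rewrite <- Hg'p. apply Hgd. }
  { exact Hgp. }
  { apply Rdiv_lt_0_compat; lra. }
  set (delta := Rmin eps (Rmin 1 (r / 2))).
  assert (Hdelta : 0 < delta /\ delta <= eps /\ delta <= 1 /\ delta < r).
  { unfold delta. pose proof (Rmin_l eps (Rmin 1 (r / 2))).
    pose proof (Rmin_r eps (Rmin 1 (r / 2))).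
    pose proof (Rmin_l 1 (r / 2)). pose proof (Rmin_r 1 (r / 2)).
    repeat split; [|lra|lra|lra]. repeat apply Rmin_pos; lra. }
  destruct Hdelta as [Hd0 [Hdeps [Hd1 Hdr]]].
  assert (Hgm : 0 < a * g (p - delta)).
  { apply Hsign; [lra|]. replace (p - delta - p) with (- delta) by ring.
    rewrite Rabs_Ropp, Rabs_right; lra. }
  assert (Hgp' : 0 < a * g (p + delta)).
  { apply Hsign; [lra|]. replace (p + delta - p) with delta by ring.
    rewrite Rabs_right; lra. }
  set (m := Rmin (a * g (p - delta)) (a * g (p + delta))).
  assert (Hm : 0 < m) by (now apply Rmin_pos).
  pose proof (Rmin_l (a * g (p - delta)) (a * g (p + delta))) as Hm1.
  pose proof (Rmin_r (a * g (p - delta)) (a * g (p + delta))) as Hm2.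
  fold m in Hm1, Hm2.
  (* The four bounds make, in turn, the constants barriers, the averaged curve
     lie between them, the bound on [g] near [p] apply along that curve, and the
     variation of [f] along it negligible. *)
  set (l1 := m / (Rabs a * M)). set (l2 := delta / B).
  set (l3 := r1 / (2 * B)). set (l4 := Rabs c / (4 * (L * B))).
  assert (HLB : 0 < L * B) by nra. assert (HaM : 0 < Rabs a * M) by nra.
  exists (Rmin (Rmin l1 l2) (Rmin l3 l4)). split.
  { repeat apply Rmin_pos; apply Rdiv_lt_0_compat; lra. }
  intros lam [Hlam Hlams].
  assert (Hl1 : lam * (Rabs a * M) <= m).
  { apply Rle_trans with (l1 * (Rabs a * M)).
    - apply Rmult_le_compat_r; [lra|]. eapply Rle_trans; [exact Hlams|].
      eapply Rle_trans; [apply Rmin_l|apply Rmin_l].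
    - right. unfold l1. field. lra. }
  assert (Hl2 : lam * B <= delta).
  { apply Rle_trans with (l2 * B).
    - apply Rmult_le_compat_r; [lra|]. eapply Rle_trans; [exact Hlams|].
      eapply Rle_trans; [apply Rmin_l|apply Rmin_r].
    - right. unfold l2. field. lra. }
  assert (Hl3 : lam * B < r1).
  { apply Rle_lt_trans with (l3 * B).
    - apply Rmult_le_compat_r; [lra|]. eapply Rle_trans; [exact Hlams|].
      eapply Rle_trans; [apply Rmin_r|apply Rmin_l].
    - unfold l3. replace (r1 / (2 * B) * B) with (r1 / 2) by (field; lra). lra. }
  assert (Hl4 : lam * (L * B) <= Rabs c / 4).
  { apply Rle_trans with (l4 * (L * B)).
    - apply Rmult_le_compat_r; [lra|]. eapply Rle_trans; [exact Hlams|].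
      eapply Rle_trans; [apply Rmin_r|apply Rmin_r].
    - right. unfold l4. field. lra. }
  set (F := fun t x => g x + lam * f t x).
  set (beta := fun t => p + lam * psi t).
  set (beta' := fun t => lam * (f t p - c)).
  assert (Hbeta : forall t, is_derive beta t (beta' t)).
  { intros t. unfold beta, beta'. replace (lam * (f t p - c)) with (0 + lam * (f t p - c)) by ring.
    apply (is_derive_plus (fun _ => p) (fun t => lam * psi t));
      [apply is_derive_Reals, derivable_pt_lim_const|]. apply (is_derive_scal psi t lam), Hpsi. }
  assert (HbetaT : periodic T beta) by (intros t; unfold beta; now rewrite HpsiT).
  assert (Hbp : forall t, Rabs (beta t - p) <= lam * B).
  { intros t. unfold beta. replace (p + lam * psi t - p) with (lam * psi t) by ring.
    rewrite Rabs_mult, (Rabs_right lam) by lra. apply Rmult_le_compat_l; [lra|apply HBb]. }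
  assert (Hbd : forall t, p - delta <= beta t <= p + delta).
  { intros t. specialize (Hbp t). apply Rabs_le_between in Hbp. lra. }
  assert (Hstrict : forall t, 0 < a * (beta' t - F t (beta t))).
  { intros t. specialize (Hbp t). specialize (Hbd t). unfold beta', F.
    set (x := beta t) in *.
    assert (H1 : Rabs (g x) <= lam * (Rabs c / 4)).
    { eapply Rle_trans; [apply Hsmall; lra|].
      apply Rle_trans with (Rabs c / (4 * B) * (lam * B)).
      - apply Rmult_le_compat_l; [|exact Hbp]. left. apply Rdiv_lt_0_compat; lra.
      - right. field. lra. }
    assert (H2 : Rabs (f t x - f t p) <= Rabs c / 4).
    { eapply Rle_trans; [apply HLb; lra|]. eapply Rle_trans; [|exact Hl4].
      replace (lam * (L * B)) with (L * (lam * B)) by ring.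
      apply Rmult_le_compat_l; lra. }
    set (e := g x + lam * (f t x - f t p)).
    replace (a * (lam * (f t p - c) - (g x + lam * f t x)))
      with (- (lam * (a * c)) - a * e) by (unfold e; ring).
    assert (He : Rabs e <= lam * (Rabs c / 2)).
    { unfold e. eapply Rle_trans; [apply Rabs_triang|].
      rewrite Rabs_mult, (Rabs_right lam) by lra.
      assert (lam * Rabs (f t x - f t p) <= lam * (Rabs c / 4))
        by (apply Rmult_le_compat_l; lra). lra. }
    assert (Hae : a * e <= Rabs a * (lam * (Rabs c / 2))).
    { eapply Rle_trans; [apply Rle_abs|]. rewrite Rabs_mult.
      apply Rmult_le_compat_l; lra. }
    rewrite Hacabs. assert (0 < lam * (Rabs a * Rabs c)) by (repeat apply Rmult_lt_0_compat; lra).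
    nra. }
  assert (Hconst : forall t x, p - 1 <= x <= p + 1 -> m <= a * g x -> 0 <= a * F t x).
  { intros t x Hx Hmx. unfold F.
    assert (Rabs (a * (lam * f t x)) <= m).
    { eapply Rle_trans; [|exact Hl1]. rewrite !Rabs_mult, (Rabs_right lam) by lra.
      replace (Rabs a * (lam * Rabs (f t x))) with ((lam * Rabs a) * Rabs (f t x)) by ring.
      rewrite <- Rmult_assoc. apply Rmult_le_compat_l; [nra|]. now apply HMb. }
    pose proof (Rle_abs (- (a * (lam * f t x)))) as H0. rewrite Rabs_Ropp in H0. lra. }
  assert (HFc : forall t x, continuity_2d_pt F t x).
  { intros t x. apply continuity_2d_pt_plus.
    - apply (continuity_1d_2d_pt_comp g (fun _ x => x)); [|apply continuity_2d_pt_id2].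
      apply continuous_continuity. intros y. eapply is_derive_continuous, Hgd.
    - apply continuity_2d_pt_mult; [apply continuity_2d_pt_const|apply Hfc]. }
  assert (HFT : forall t x, F (t + T) x = F t x) by (intros t x; unfold F; now rewrite Hper).
  assert (HFb : forall t x, p - 1 <= x <= p + 1 -> Rabs (F t x) <= Lg + lam * M).
  { intros t x Hx. unfold F. eapply Rle_trans; [apply Rabs_triang|].
    rewrite Rabs_mult, (Rabs_right lam) by lra.
    assert (lam * Rabs (f t x) <= lam * M)
      by (apply Rmult_le_compat_l; [lra|now apply HMb]).
    specialize (HLgb p x ltac:(lra) Hx). rewrite Hgp, Rminus_0_r in HLgb.
    assert (Rabs (x - p) <= 1) by (apply Rabs_le; lra). nra. }
  assert (HFl : forall t x y, p - 1 <= x <= p + 1 -> p - 1 <= y <= p + 1 ->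
            Rabs (F t y - F t x) <= (Lg + lam * L) * Rabs (y - x)).
  { intros t x y Hx Hy. unfold F.
    replace (g y + lam * f t y - (g x + lam * f t x))
      with ((g y - g x) + lam * (f t y - f t x)) by ring.
    eapply Rle_trans; [apply Rabs_triang|].
    rewrite Rabs_mult, (Rabs_right lam) by lra.
    specialize (HLgb x y Hx Hy). specialize (HLb t x y Hx Hy).
    assert (lam * Rabs (f t y - f t x) <= lam * (L * Rabs (y - x)))
      by (apply Rmult_le_compat_l; lra). lra. }
  assert (HK : 0 < Lg + lam * L) by nra.
  assert (Ha0 : a <> 0) by (intros H; rewrite H in Hac; lra).
  destruct (periodic_solution_between_signed a T F (Lg + lam * L) (Lg + lam * M)
              (p - 1) (p + 1) (fun _ => p - delta) (fun _ => 0) beta beta')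
    as [x1 [Hx1 [Hx1T Hx1b]]]; try assumption.
  { intros t. apply is_derive_Reals, derivable_pt_lim_const. }
  { intros t. reflexivity. }
  { intros t. lra. }
  { intros t. apply Hbd. }
  { intros t. specialize (Hbd t). lra. }
  { intros t. pose proof (Hconst t (p - delta) ltac:(lra) Hm1). lra. }
  { intros t. left. apply Hstrict. }
  destruct (periodic_solution_between_signed (- a) T F (Lg + lam * L) (Lg + lam * M)
              (p - 1) (p + 1) beta beta' (fun _ => p + delta) (fun _ => 0))
    as [x2 [Hx2 [Hx2T Hx2b]]]; try assumption.
  { lra. }
  { intros t. apply is_derive_Reals, derivable_pt_lim_const. }
  { intros t. reflexivity. }
  { intros t. specialize (Hbd t). lra. }
  { intros t. apply Hbd. }
  { intros t. lra. }
  { intros t. specialize (Hstrict t). lra. }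
  { intros t. pose proof (Hconst t (p + delta) ltac:(lra) Hm2). lra. }
  (* A contact of [x1] with the strict barrier [beta] would make the slopes agree. *)
  assert (Hlt : forall t, x1 t < beta t).
  { intros t. destruct (Rle_lt_or_eq_dec _ _ (proj2 (Hx1b t))) as [H|H]; [exact H|exfalso].
    assert (H0 : beta' t - F t (x1 t) = 0).
    { apply (derive_at_extremum (-1) (fun t => beta t - x1 t) t); [lra| |].
      - apply (is_derive_minus beta x1); [apply Hbeta|apply Hx1].
      - intros y. specialize (Hx1b y). lra. }
    specialize (Hstrict t). rewrite <- H, H0 in Hstrict. lra. }
  exists x1, x2.
  split; [split; [exact Hx1|exact Hx1T]|]. split.
  { intros t. specialize (Hx1b t). specialize (Hbd t). lra. }
  split; [split; [exact Hx2|exact Hx2T]|]. split.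
  { intros t. specialize (Hx2b t). specialize (Hbd t). lra. }
  apply (ordered_geometrically_distinct T); try assumption.
  - intros t. eapply is_derive_continuous, Hx1.
  - intros t. specialize (Hlt t). specialize (Hx2b t). lra.
Qed.

(** * Signed count of zeros and components *)

Definition sum_signs (h : R -> R) (l : list R) : R :=
  fold_right Rplus 0 (map (fun x => sign (Derive h x)) l).

(** The predicates of interest are memberships in sets of reals, which are not
    decidable, so boolean filtering does not apply. *)
Lemma list_split_classical (P : R -> Prop) (h : R -> R) (l : list R) :
  NoDup l ->
  exists l1 l2, NoDup l1 /\ NoDup l2 /\
    (length l1 + length l2 = length l)%nat /\
    sum_signs h l = sum_signs h l1 + sum_signs h l2 /\
    (forall x, In x l1 <-> In x l /\ P x) /\
    (forall x, In x l2 <-> In x l /\ ~ P x).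
Proof.
  intros Hl. induction Hl as [|z l Hz Hl [l1 [l2 [H1 [H2 [Hlen [Hs [Hi1 Hi2]]]]]]]].
  - exists nil, nil. unfold sum_signs; simpl.
    repeat split; try constructor; try lra; tauto.
  - destruct (classic (P z)) as [HP|HP].
    + exists (z :: l1), l2.
      split; [constructor; [rewrite Hi1; tauto|exact H1]|].
      split; [exact H2|]. split; [simpl; lia|].
      split; [unfold sum_signs in *; simpl; lra|]. split; intros x; simpl.
      * rewrite Hi1. split; [|tauto]. intros [<-|H]; tauto.
      * rewrite Hi2. split; [tauto|]. intros [[<-|H] Hn]; tauto.
    + exists l1, (z :: l2). split; [exact H1|].
      split; [constructor; [rewrite Hi2; tauto|exact H2]|]. split; [simpl; lia|].
      split; [unfold sum_signs in *; simpl; lra|]. split; intros x; simpl.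
      * rewrite Hi1. split; [tauto|]. intros [[<-|H] Hn]; tauto.
      * rewrite Hi2. split; [|tauto]. intros [<-|H]; tauto.
Qed.

Lemma sign_near_simple_zero (h : R -> R) (z : R) :
  ex_derive h z -> h z = 0 -> Derive h z <> 0 ->
  exists e, 0 < e /\ forall x, 0 < Rabs (x - z) < e ->
    h x <> 0 /\ sign (h x) = sign (Derive h z) * sign (x - z).
Proof.
  intros Hd Hz Hn. apply Derive_correct, is_derive_Reals in Hd.
  set (b := Derive h z) in *.
  destruct (Hd (Rabs b) (Rabs_pos_lt b Hn)) as [e He].
  exists e. split; [apply cond_pos|]. intros x [Hx0 Hxe].
  assert (Hxz : x - z <> 0) by (intros H; rewrite H, Rabs_R0 in Hx0; lra).
  specialize (He (x - z) Hxz Hxe). replace (z + (x - z)) with x in He by ring.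
  rewrite Hz, Rminus_0_r in He.
  set (k := h x / (x - z)) in *.
  assert (Hk : h x = k * (x - z)) by (unfold k; field; exact Hxz).
  assert (Hs : k <> 0 /\ sign k = sign b).
  { apply Rabs_def2 in He. destruct (Rlt_le_dec 0 b).
    - rewrite Rabs_right in He by lra. split; [lra|]. rewrite !sign_eq_1; lra.
    - assert (b < 0) by lra. rewrite Rabs_left in He by lra. split; [lra|].
      rewrite !sign_eq_m1; lra. }
  rewrite Hk. split; [apply Rmult_integral_contrapositive; tauto|].
  rewrite sign_mult. now rewrite (proj2 Hs).
Qed.

Lemma same_sign_eq (x y : R) : 0 < x * y -> sign x = sign y.
Proof.
  intros H. destruct (Rtotal_order x 0) as [|[|]]; [|subst; lra|].
  - rewrite !sign_eq_m1 by nra. reflexivity.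
  - rewrite !sign_eq_1 by nra. reflexivity.
Qed.

(** Cutting the interval on both sides of one zero [z], where [h] has the signs
    [- sign (h' z)] and [sign (h' z)], reduces the count to shorter lists. *)
Lemma interval_degree (h : R -> R) (n : nat) :
  (forall x, ex_derive h x) ->
  forall c d l, (length l <= n)%nat -> c <= d -> h c <> 0 -> h d <> 0 -> NoDup l ->
    (forall x, In x l <-> c <= x <= d /\ h x = 0) ->
    (forall x, In x l -> Derive h x <> 0) ->
    sum_signs h l = (sign (h d) - sign (h c)) / 2.
Proof.
  intros Hh.
  assert (Hcont : continuity h)
    by (apply continuous_continuity; intros x; now apply (ex_derive_continuous h)).
  induction n as [|n IH]; intros c d l Hlen Hcd Hc Hd Hnd Hin Hreg;
    destruct l as [|z l]; simpl in Hlen; try lia.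
  1, 2: assert (Hs : 0 < h c * h d) by
    (apply no_zero_same_sign; [exact Hcont|]; intros x Hx H0;
     rewrite Rmin_left, Rmax_right in Hx by lra; apply (proj2 (Hin x)); tauto);
    rewrite (same_sign_eq _ _ Hs); unfold sum_signs; simpl; lra.
  destruct (proj1 (Hin z) (or_introl eq_refl)) as [Hz Hz0].
  assert (Hzd := Hreg z (or_introl eq_refl)).
  assert (c < z < d).
  { split; apply Rnot_le_lt; intros Hle.
    - apply Hc. replace c with z by lra. exact Hz0.
    - apply Hd. replace d with z by lra. exact Hz0. }
  destruct (sign_near_simple_zero h z (Hh z) Hz0 Hzd) as [e [He Hsz]].
  set (k := Rmin (e / 2) (Rmin (z - c) (d - z))).
  assert (Hk : 0 < k /\ k < e /\ c <= z - k /\ z + k <= d).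
  { unfold k. pose proof (Rmin_l (e / 2) (Rmin (z - c) (d - z))).
    pose proof (Rmin_r (e / 2) (Rmin (z - c) (d - z))).
    pose proof (Rmin_l (z - c) (d - z)). pose proof (Rmin_r (z - c) (d - z)).
    repeat split; [repeat apply Rmin_pos|..]; lra. }
  destruct Hk as [Hk0 [Hke [Hkc Hkd]]].
  destruct (Hsz (z - k)) as [Hl0 Hls].
  { replace (z - k - z) with (- k) by ring. rewrite Rabs_Ropp, Rabs_right; lra. }
  destruct (Hsz (z + k)) as [Hr0 Hrs].
  { replace (z + k - z) with k by ring. rewrite Rabs_right; lra. }
  rewrite (sign_eq_m1 (z - k - z)) in Hls by lra.
  rewrite (sign_eq_1 (z + k - z)) in Hrs by lra.
  inversion Hnd as [|? ? Hzl Hndl]; subst.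
  destruct (list_split_classical (fun x => x < z) h l Hndl)
    as [l1 [l2 [H1 [H2 [Hlen' [Hs [Hi1 Hi2]]]]]]].
  assert (Hgap : forall x, x <> z -> h x = 0 -> ~ (z - k < x < z + k)).
  { intros x Hx Hx0 Hb. destruct (Hsz x) as [Hn _]; [|contradiction].
    split; [apply Rabs_pos_lt; lra|apply Rabs_def1; lra]. }
  assert (E1 : sum_signs h l1 = (sign (h (z - k)) - sign (h c)) / 2).
  { apply IH; try assumption; try lia.
    - intros x. rewrite Hi1. split.
      + intros [Hx Hxz]. destruct (proj1 (Hin x) (or_intror Hx)) as [Hxb Hx0].
        specialize (Hgap x ltac:(lra) Hx0). split; [lra|exact Hx0].
      + intros [Hx Hx0]. split; [|lra].
        destruct (proj2 (Hin x)) as [Heq|Hx']; [split; [lra|exact Hx0]|lra|exact Hx'].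
    - intros x Hx. apply Hreg. right. now apply Hi1. }
  assert (E2 : sum_signs h l2 = (sign (h d) - sign (h (z + k))) / 2).
  { apply IH; try assumption; try lia.
    - intros x. rewrite Hi2. split.
      + intros [Hx Hxz]. destruct (proj1 (Hin x) (or_intror Hx)) as [Hxb Hx0].
        assert (x <> z) by (intros ->; contradiction).
        specialize (Hgap x ltac:(assumption) Hx0). split; [lra|exact Hx0].
      + intros [Hx Hx0]. split; [|lra].
        destruct (proj2 (Hin x)) as [Heq|Hx']; [split; [lra|exact Hx0]|lra|exact Hx'].
    - intros x Hx. apply Hreg. right. now apply Hi2. }
  change (sum_signs h (z :: l)) with (sign (Derive h z) + sum_signs h l).
  rewrite Hs, E1, E2, Hls, Hrs. lra.
Qed.

(** The right end is a supremum; reflection of [U] gives the left end. *)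
Lemma component_exists (U : R -> Prop) (z : R) :
  open_set U -> bounded U -> U z ->
  exists c d, c < z < d /\ ~ U c /\ ~ U d /\ (forall x, c < x < d -> U x).
Proof.
  intros HO [lo [hi Hb]] Hz.
  assert (Hright : forall V : R -> Prop, (forall x, V x -> exists e, 0 < e /\
             forall y, Rabs (y - x) < e -> V y) -> forall w M, V w -> (forall x, V x -> x <= M) ->
             exists d, w < d /\ ~ V d /\ forall x, w <= x < d -> V x).
  { intros V HV w M Hw HM.
    set (E := fun d => w <= d /\ forall x, w <= x <= d -> V x).
    destruct (completeness E) as [d [Hub Hlub]].
    { exists M. intros x [Hx HE]. apply HM, HE. lra. }
    { exists w. split; [lra|]. intros x Hx. now replace x with w by lra. }
    destruct (HV w Hw) as [e [He Hwe]].
    assert (Hwd : w + e / 2 <= d).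
    { apply Hub. split; [lra|]. intros x Hx. apply Hwe, Rabs_def1; lra. }
    assert (Hall : forall x, w <= x < d -> V x).
    { intros x Hx. apply NNPP. intros Hn. assert (d <= x); [|lra].
      apply Hlub. intros y [Hy HE]. apply Rnot_lt_le. intros Hxy. apply Hn, HE. lra. }
    exists d. repeat split; [lra| |exact Hall]. intros Hd.
    destruct (HV d Hd) as [e' [He' Hde]].
    assert (d + e' / 2 <= d); [|lra]. apply Hub. split; [lra|]. intros x Hx.
    destruct (Rlt_le_dec x d); [apply Hall; lra|]. apply Hde, Rabs_def1; lra. }
  assert (HO' : forall x, U x -> exists e, 0 < e /\ forall y, Rabs (y - x) < e -> U y).
  { intros x Hx. destruct (HO x Hx) as [e He]. exists e. split; [apply cond_pos|exact He]. }
  destruct (Hright U HO' z hi Hz) as [d [Hzd [HUd Hd]]]; [intros x Hx; apply (Hb x Hx)|].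
  destruct (Hright (fun x => U (- x))) with (w := - z) (M := - lo) as [c [Hzc [HUc Hc]]].
  - intros x Hx. destruct (HO' _ Hx) as [e [He HH]]. exists e. split; [exact He|].
    intros y Hy. apply HH. replace (- y - - x) with (- (y - x)) by ring.
    now rewrite Rabs_Ropp.
  - now rewrite Ropp_involutive.
  - intros x Hx. specialize (Hb _ Hx). lra.
  - exists (- c), d. repeat split; try assumption; try lra.
    intros x Hx. destruct (Rle_lt_dec z x); [apply Hd; lra|].
    rewrite <- (Ropp_involutive x). apply Hc. lra.
Qed.

(** Every component of [U] contributes [0].  There may be infinitely many of them,
    so the induction is on the number of zeros: it removes, together with one
    zero, all zeros in the component of that zero. *)
Lemma degree_zero_by_components (h : R -> R) (n : nat) :
  (forall x, ex_derive h x) ->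
  forall (U : R -> Prop) l, (length l <= n)%nat -> NoDup l ->
    (forall x, In x l <-> U x /\ h x = 0) ->
    (forall x, U x -> h x = 0 -> Derive h x <> 0) ->
    (forall x, U x -> exists c d, c < x < d /\ ~ U c /\ ~ U d /\
                                  (forall y, c < y < d -> U y)) ->
    (forall c d, c < d -> ~ U c -> ~ U d -> (forall y, c < y < d -> U y) ->
       0 < h c * h d) ->
    sum_signs h l = 0.
Proof.
  intros Hh. induction n as [|n IH]; intros U l Hlen Hnd Hin Hreg Hcomp Hends;
    destruct l as [|z l]; simpl in Hlen; try lia; try reflexivity.
  destruct (proj1 (Hin z) (or_introl eq_refl)) as [Hz Hz0].
  destruct (Hcomp z Hz) as [c [d [Hcd [HUc [HUd Hcd']]]]].
  assert (Hs := Hends c d ltac:(lra) HUc HUd Hcd').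
  destruct (list_split_classical (fun x => c < x < d) h (z :: l) Hnd)
    as [l1 [l2 [H1 [H2 [Hlen' [Hsum [Hi1 Hi2]]]]]]].
  assert (Hz1 : In z l1) by (apply Hi1; split; [left; reflexivity|exact Hcd]).
  assert (length l1 <> 0%nat) by (destruct l1; [destruct Hz1|discriminate]).
  simpl in Hlen'.
  assert (Hc0 : h c <> 0) by (intros H0; rewrite H0 in Hs; lra).
  assert (Hd0 : h d <> 0) by (intros H0; rewrite H0 in Hs; lra).
  assert (E1 : sum_signs h l1 = (sign (h d) - sign (h c)) / 2).
  { apply (interval_degree h (length l1) Hh); try assumption; try lra; try lia.
    - intros x. rewrite Hi1, Hin. split.
      + intros [[_ Hx0] Hx]. split; [lra|exact Hx0].
      + intros [Hx Hx0].
        assert (x <> c) by (intros ->; contradiction).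
        assert (x <> d) by (intros ->; contradiction).
        assert (c < x < d) by lra. repeat split; try assumption; try lra. now apply Hcd'.
    - intros x Hx. apply Hi1 in Hx. destruct Hx as [Hx _]. apply Hin in Hx.
      apply Hreg; apply Hx. }
  assert (E2 : sum_signs h l2 = 0).
  { apply (IH (fun x => U x /\ ~ (c < x < d))); try assumption; try lia.
    - intros x. rewrite Hi2, Hin. tauto.
    - intros x [Hx _]. now apply Hreg.
    - intros x [Hx Hxcd]. destruct (Hcomp x Hx) as [c' [d' [H' [Hc' [Hd' HU']]]]].
      exists c', d'. split; [exact H'|]. split; [tauto|]. split; [tauto|].
      (* Two maximal intervals are equal or disjoint. *)
      intros y Hy. split; [now apply HU'|]. intros Hyc.
      assert (~ (c' < c < d')) by (intros Hn; apply HUc, HU', Hn).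
      assert (~ (c' < d < d')) by (intros Hn; apply HUd, HU', Hn).
      apply Hxcd. lra.
    - intros c' d' H' Hc' Hd' HU'. apply Hends; [exact H'| | |apply HU'].
      + intros Hc. assert (Hcc : c < c' < d) by (apply NNPP; intros Hn; apply Hc'; tauto).
        set (y := Rmin ((c' + d) / 2) ((c' + d') / 2)).
        assert (Hy : c' < y /\ y < d /\ y < d').
        { unfold y. pose proof (Rmin_l ((c' + d) / 2) ((c' + d') / 2)).
          pose proof (Rmin_r ((c' + d) / 2) ((c' + d') / 2)).
          split; [apply Rmin_glb_lt; lra|lra]. }
        apply (proj2 (HU' y ltac:(lra))). lra.
      + intros Hd. assert (Hdd : c < d' < d) by (apply NNPP; intros Hn; apply Hd'; tauto).
        set (y := Rmax ((c + d') / 2) ((c' + d') / 2)).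
        assert (Hy : c < y /\ c' < y /\ y < d').
        { unfold y. pose proof (Rmax_l ((c + d') / 2) ((c' + d') / 2)).
          pose proof (Rmax_r ((c + d') / 2) ((c' + d') / 2)).
          split; [lra|split; [lra|apply Rmax_lub_lt; lra]]. }
        apply (proj2 (HU' y ltac:(lra))). lra. }
  rewrite Hsum, E1, E2, (same_sign_eq _ _ Hs). lra.
Qed.

(** * Adherent points and the list of zeros *)

Lemma not_adherent (U : R -> Prop) (x : R) :
  ~ adherence U x -> exists d, 0 < d /\ forall y, Rabs (y - x) < d -> ~ U y.
Proof.
  intros H. apply NNPP. intros Hn. apply H. intros V [d Hd].
  apply NNPP. intros Hno. apply Hn. exists d. split; [apply cond_pos|].
  intros y Hy HU. apply Hno. exists y. split; [now apply Hd|exact HU].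
Qed.

Lemma adherent_self (U : R -> Prop) (x : R) : U x -> adherence U x.
Proof.
  intros H V [d Hd]. exists x. split; [|exact H]. apply Hd.
  unfold disc. rewrite Rminus_diag, Rabs_R0. apply cond_pos.
Qed.

Lemma adherence_complement_open (U : R -> Prop) (x : R) :
  ~ adherence U x -> exists d, 0 < d /\ forall y, Rabs (y - x) < d -> ~ adherence U y.
Proof.
  intros H. destruct (not_adherent U x H) as [d [Hd HU]]. exists (d / 2).
  split; [lra|]. intros y Hy HA.
  destruct (HA (disc y (mkposreal (d / 2) ltac:(lra)))) as [w [Hw HUw]].
  { exists (mkposreal (d / 2) ltac:(lra)). intros w Hw. exact Hw. }
  unfold disc in Hw; simpl in Hw. apply (HU w); [|exact HUw].
  replace (w - x) with ((w - y) + (y - x)) by ring.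
  eapply Rle_lt_trans; [apply Rabs_triang|lra].
Qed.

Lemma adherence_bounded (U : R -> Prop) (a b : R) :
  (forall x, U x -> a <= x <= b) -> forall x, adherence U x -> a <= x <= b.
Proof.
  intros HU x Hx. split; apply Rnot_lt_le; intros Hlt.
  - destruct (Hx (fun y => y < a)) as [y [Hy HUy]].
    { exists (mkposreal (a - x) ltac:(lra)). intros y Hy. unfold disc in Hy; simpl in Hy.
      apply Rabs_def2 in Hy. lra. }
    specialize (HU y HUy). lra.
  - destruct (Hx (fun y => b < y)) as [y [Hy HUy]].
    { exists (mkposreal (x - b) ltac:(lra)). intros y Hy. unfold disc in Hy; simpl in Hy.
      apply Rabs_def2 in Hy. lra. }
    specialize (HU y HUy). lra.
Qed.

Lemma open_frontier_outside (U : R -> Prop) (x : R) :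
  open_set U -> frontier U x -> ~ U x.
Proof.
  intros HO [_ Hf] Hx. destruct (HO x Hx) as [d Hd].
  destruct (Hf (disc x d)) as [y [Hy HUy]]; [now exists d|]. apply HUy, Hd, Hy.
Qed.

Lemma component_end_frontier (U : R -> Prop) (c d e : R) :
  c < d -> (forall x, c < x < d -> U x) -> ~ U e -> e = c \/ e = d -> frontier U e.
Proof.
  intros Hcd HU He Hend. split; [|now apply adherent_self].
  intros V [k Hk]. pose proof (cond_pos k).
  pose (m := Rmin (k / 2) ((d - c) / 2)).
  assert (Hm : 0 < m /\ m < k /\ m < d - c).
  { unfold m. pose proof (Rmin_l (k / 2) ((d - c) / 2)).
    pose proof (Rmin_r (k / 2) ((d - c) / 2)). split; [apply Rmin_pos; lra|lra]. }
  destruct Hend as [-> | ->]; [exists (c + m)|exists (d - m)];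
    (split; [apply Hk; unfold disc; apply Rabs_def1; lra|apply HU; lra]).
Qed.

(** Simple zeros are isolated, and points of the frontier are no zeros, so by
    gluing the zeros in [U] can be listed. *)
Lemma regular_zeros_listed (h : R -> R) (U : R -> Prop) :
  (forall x, ex_derive h x) -> bounded U ->
  (forall x, frontier U x -> h x <> 0) ->
  (forall x, U x -> h x = 0 -> Derive h x <> 0) ->
  exists l, NoDup l /\ forall x, In x l <-> U x /\ h x = 0.
Proof.
  intros Hh [a [b Hab]] Hfr Hreg.
  assert (Hfin : exists l, forall x, U x -> h x = 0 -> In x l).
  { destruct (Rle_lt_dec a b) as [Hle|Hlt].
    2: { exists nil. intros x Hx. specialize (Hab x Hx). lra. }
    cut (exists l, forall x, a <= x <= b -> U x -> h x = 0 -> In x l).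
    { intros [l Hl]. exists l. intros x Hx. apply Hl; auto. }
    apply (interval_gluing (fun u v => exists l, forall x, u <= x <= v ->
             U x -> h x = 0 -> In x l) a b Hle).
    { intros u v w [l Hl] [l' Hl']. exists (l ++ l'). intros x Hx HU H0.
      apply in_or_app. destruct (Rle_dec x v); [left; apply Hl|right; apply Hl'];
        auto; lra. }
    intros x Hx.
    assert (exists e, 0 < e /\ forall y, Rabs (y - x) < e -> U y -> h y = 0 -> y = x)
      as [e [He Hiso]].
    { destruct (Req_dec (h x) 0) as [H0|H0].
      - destruct (classic (U x)) as [HU|HU].
        + destruct (sign_near_simple_zero h x (Hh x) H0 (Hreg x HU H0)) as [e [He HH]].
          exists e. split; [exact He|]. intros y Hy _ Hy0. apply NNPP. intros Hn.
          destruct (HH y) as [Hne _]; [|contradiction].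
          split; [apply Rabs_pos_lt; lra|exact Hy].
        + destruct (not_adherent U x) as [e [He HH]].
          { intros HA. apply (Hfr x); [|exact H0].
            split; [exact HA|now apply adherent_self]. }
          exists e. split; [exact He|]. intros y Hy HUy. exfalso. exact (HH y Hy HUy).
      - destruct (proj1 (continuous_eps_delta h x) (ex_derive_continuous h x (Hh x))
                    (Rabs (h x)) (Rabs_pos_lt _ H0)) as [e [He HH]].
        exists e. split; [exact He|]. intros y Hy _ Hy0. specialize (HH y Hy).
        rewrite Hy0, Rminus_0_l, Rabs_Ropp in HH. lra. }
    exists e. split; [exact He|]. intros u v Hu Hv. exists (x :: nil).
    intros y Hy HU H0. left. symmetry. apply Hiso; auto. apply Rabs_def1; lra. }
  destruct Hfin as [l Hl].
  assert (Hnd : NoDup (nodup Req_dec_T l)) by apply NoDup_nodup.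
  destruct (list_split_classical (fun x => U x /\ h x = 0) h _ Hnd)
    as [l1 [_ [H1 [_ [_ [_ [Hi _]]]]]]].
  exists l1. split; [exact H1|]. intros x. rewrite Hi, nodup_In. split; [tauto|].
  intros Hx. split; [now apply Hl|exact Hx].
Qed.

(** * The index *)

Lemma small_with_sign (a m : R) :
  a <> 0 -> 0 < m -> exists c, 0 < a * c /\ Rabs c < m.
Proof.
  intros Ha Hm. destruct (Rlt_le_dec 0 a).
  - exists (m / 2). split; [nra|]. rewrite Rabs_right; lra.
  - exists (- (m / 2)). split; [nra|]. rewrite Rabs_Ropp, Rabs_right; lra.
Qed.

(** Where [a * g] is positive on both sides of [p], adding a small constant of
    the sign of [a] removes the zero, which gives a regular approximation.  Any
    other one has the signs of [g] on the frontier, and these agree at the two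
    ends of each component of [U]. *)
Lemma index_zero (g : R -> R) (a p r : R) :
  C_n 1 g -> isolated_zero g p -> a <> 0 -> 0 < r ->
  (forall x, x <> p -> Rabs (x - p) < r -> 0 < a * g x) ->
  is_index g p 0.
Proof.
  intros Hg Hiso Ha Hr Hsign. split; [exact Hiso|].
  intros U [HO [Hbd [HUp Hz]]]. destruct Hiso as [Hgp _].
  assert (Hgc : forall x, continuous g x) by (intros x; apply (Hg 0%nat x); lia).
  assert (Hgcont := continuous_continuity g Hgc).
  assert (Hfr : forall x, frontier U x -> g x <> 0).
  { intros x Hx H0. apply (open_frontier_outside U x HO Hx).
    now rewrite (Hz x (proj1 Hx) H0). }
  destruct Hbd as [lo [hi Hb]].
  destruct (HO p HUp) as [rU HrU].
  destruct (bounded_away_from_zero g (adherence U) p (Rmin r rU) lo hi)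
    as [m [Hm Hmb]].
  - specialize (Hb p HUp). lra.
  - apply Rmin_pos; [exact Hr|apply cond_pos].
  - exact Hgc.
  - now apply adherence_bounded.
  - apply adherence_complement_open.
  - exact Hz.
  - split; [|split].
    + repeat split; [exact Hgc|exact HO|now exists lo, hi|exact Hfr].
    + destruct (small_with_sign a m Ha Hm) as [c [Hac Hcm]].
      assert (Hder : forall x, is_derive (fun y => g y + c) x (Derive g x)).
      { intros x. rewrite <- (Rplus_0_r (Derive g x)).
        apply (is_derive_plus g (fun _ => c)).
        - apply Derive_correct, (Hg 1%nat x). lia.
        - apply is_derive_Reals, derivable_pt_lim_const. }
      exists (fun x => g x + c). split; [|split].
      * intros k x Hk. destruct k as [|[|k]]; [| |lia].
        -- split; [exact I|]. apply (continuous_plus g (fun _ => c));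
             [apply Hgc|apply continuous_const].
        -- split; [exists (Derive g x); apply Hder|].
           apply (continuous_ext (Derive g)).
           ++ intros y. symmetry. apply (is_derive_unique (fun y => g y + c)), Hder.
           ++ apply (Hg 1%nat x). lia.
      * intros x HUx H0 _. simpl in H0.
        assert (Hxr : Rabs (x - p) < Rmin r rU).
        { apply Hmb; [now apply adherent_self|].
          replace (g x) with (- c) by lra. now rewrite Rabs_Ropp. }
        pose proof (Rmin_l r rU).
        destruct (Req_dec x p) as [->|Hn].
        -- replace c with 0 in Hac by lra. lra.
        -- specialize (Hsign x Hn ltac:(lra)). nra.
      * intros x y _ Hy. replace (g x + c - g x) with c by ring.
        apply Rlt_le_trans with m; [exact Hcm|]. apply Rnot_lt_le. intros Hlt.
        apply (open_frontier_outside U y HO Hy), HrU.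
        specialize (Hmb y (proj1 Hy) Hlt). pose proof (Rmin_r r rU).
        unfold disc. lra.
    + intros h [HhC [Hreg Happ]].
      assert (Hhd : forall x, ex_derive h x) by (intros x; apply (HhC 1%nat x); lia).
      assert (Hgh : forall x, frontier U x -> 0 < g x * h x).
      { intros x Hx. specialize (Happ x x (proj1 Hx) Hx).
        destruct (Rlt_le_dec 0 (g x)).
        - rewrite (Rabs_right (g x)) in Happ by lra. apply Rabs_def2 in Happ. nra.
        - rewrite (Rabs_left1 (g x)) in Happ by lra. apply Rabs_def2 in Happ. nra. }
      destruct (regular_zeros_listed h U Hhd) as [l [Hnd Hl]].
      * now exists lo, hi.
      * intros x Hx H0. specialize (Hgh x Hx). rewrite H0 in Hgh. lra.
      * exact Hreg.
      * exists l. split; [exact Hnd|]. split; [exact Hl|].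
        symmetry. apply (degree_zero_by_components h (length l) Hhd U); auto.
        { intros x Hx. apply component_exists; auto. now exists lo, hi. }
        intros c d Hcd Hc Hd HU.
        assert (Fc : frontier U c) by (apply (component_end_frontier U c d); auto).
        assert (Fd : frontier U d) by (apply (component_end_frontier U c d); auto).
        assert (Hzcd : forall x, c <= x <= d -> g x = 0 -> x = p).
        { intros x Hx H0. apply Hz; [|exact H0].
          destruct (Req_dec x c) as [->|]; [apply Fc|].
          destruct (Req_dec x d) as [->|]; [apply Fd|].
          apply adherent_self, HU. lra. }
        assert (Hgcd : 0 < g c * g d).
        { destruct (classic (c < p < d)) as [Hp|Hp].
          - assert (0 < a * g c).
            { apply (sign_propagates g a p r); try assumption; [lra|].
              intros z Hzb. apply Hzcd. rewrite Rmin_right, Rmax_left in Hzb by lra. lra. }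
            assert (0 < a * g d).
            { apply (sign_propagates g a p r); try assumption; [lra|].
              intros z Hzb. apply Hzcd. rewrite Rmin_left, Rmax_right in Hzb by lra. lra. }
            destruct (Rlt_le_dec 0 a); nra.
          - apply no_zero_same_sign; [exact Hgcont|]. intros x Hx H0.
            rewrite Rmin_left, Rmax_right in Hx by lra.
            assert (x = p) by now apply Hzcd. subst x.
            assert (p <> c) by (intros <-; contradiction).
            assert (p <> d) by (intros <-; contradiction). lra. }
        specialize (Hgh c Fc) as Hgc'. specialize (Hgh d Fd) as Hgd'.
        assert (0 < (g c * h c) * (g d * h d)) by (now apply Rmult_lt_0_compat). nra.
Qed.

Theorem proposition4p5 (T : R) (g : R -> R) (f : R -> R -> R) (p0 : R)
  (hT : 0 < T)
  (hg : C_n 2 g)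
  (hf : C_n_2d 2 f)
  (hper : forall t x : R, f (t + T) x = f t x)
  (hiso : isolated_zero g p0)
  (hres : resonant_zero T g p0) :
  (* (i) *)
  (Derive_n g 2 p0 * RInt (fun s => f s p0) 0 T > 0 ->
   forall eps : R, 0 < eps ->
   (forall x : R, p0 - eps <= x <= p0 + eps -> g x = 0 -> x = p0) ->
   exists lam_star : R, 0 < lam_star /\
     forall lam : R, 0 < lam <= lam_star ->
       ~ exists x : R -> R,
           is_periodic_solution T g f lam x /\ lies_in x (p0 - eps) (p0 + eps))
  /\
  (* (ii) *)
  (Derive_n g 2 p0 * RInt (fun s => f s p0) 0 T < 0 ->
   forall phi h : R -> R,
   (forall t x : R, f t x = phi t * h x) ->
   minimal_period T phi ->
   forall eps : R, 0 < eps ->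
   exists lam_star : R, 0 < lam_star /\
     forall lam : R, 0 < lam <= lam_star ->
       exists x1 x2 : R -> R,
         is_periodic_solution T g f lam x1 /\ lies_in x1 (p0 - eps) (p0 + eps) /\
         is_periodic_solution T g f lam x2 /\ lies_in x2 (p0 - eps) (p0 + eps) /\
         geometrically_distinct x1 x2)
  /\
  (* (iii) *)
  (Derive_n g 2 p0 * RInt (fun s => f s p0) 0 T <> 0 -> is_index g p0 0%Z).
Proof.
  assert (hg0 : g p0 = 0) by apply hiso.
  assert (hg1 := resonant_zero_degenerate T g p0 hT hres).
  assert (hgc : forall x, continuous g x) by (intros x; apply (hg 0%nat x); lia).
  assert (hsign : Derive_n g 2 p0 <> 0 -> exists r, 0 < r /\
            forall x, x <> p0 -> Rabs (x - p0) < r -> 0 < Derive_n g 2 p0 * g x)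
    by (now apply degenerate_zero_sign).
  split; [|split].
  - intros hI eps heps hz.
    destruct hsign as [r [hr hs]]; [intros h; rewrite h in hI; lra|].
    apply (no_periodic_solution T g f p0 (Derive_n g 2 p0)); try assumption.
    intros x hx hxp. apply (sign_propagates g _ p0 r); try assumption.
    + now apply continuous_continuity.
    + intros z hzb. apply hz. revert hzb. unfold Rmin, Rmax.
      repeat destruct Rle_dec; lra.
  - intros hI phi h _ _ eps heps.
    destruct hsign as [r [hr hs]]; [intros h0; rewrite h0 in hI; lra|].
    now apply (two_periodic_solutions T g f p0 (Derive_n g 2 p0) r).
  - intros hI.
    assert (ha : Derive_n g 2 p0 <> 0) by (intros h; apply hI; rewrite h; ring).
    destruct (hsign ha) as [r [hr hs]].
    apply (index_zero g (Derive_n g 2 p0) p0 r); try assumption.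
    intros k x hk. apply hg. lia.
Qed.
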